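(* The map $\Omega:\mathcal{H}^{\mathrm{dif}}\to\widetilde{\mathcal{H}^{\alpha}}$ given by $$\Omega: a_n\mapsto t_n:=\sum_{|t|=n}t\qquad(n\ge1),$$ and extended as a homomorphism of unital algebras, is an injective co-algebra homomorphism. In particular, the Hopf algebra $\mathcal{H}^{\mathrm{dif}}$ is a Hopf sub-algebra of $\widetilde{\mathcal{H}^{\alpha}}$.
   Context: **The Hopf algebra $\mathcal{H}^{\mathrm{dif}}$.** $\mathcal{H}^{\mathrm{dif}}=\mathbb{C}\langle a_1,a_2,\dots\rangle$ is the free associative unital $\mathbb{C}$-algebra on variables $a_n$, $n\ge 1$; put $a_0:=1$ and $A(x)=\sum_{n\ge 0}a_n x^{n+1}$, where power series variables commute with everything. Its co-product $\Delta^{\mathrm{dif}}$ is the unital algebra homomorphism to $\mathcal{H}^{\mathrm{dif}}\otimes\mathcal{H}^{\mathrm{dif}}$ defined on generators by $\Delta^{\mathrm{dif}}A(x):=\sum_{n\ge0}\Delta^{\mathrm{dif}}(a_n)x^{n+1}=\langle z^{-1}\rangle A(z)\otimes\frac{1}{z-A(x)}$, where $\frac1{z-A(x)}=\sum_{k\ge0}A(x)^k z^{-k-1}$ and $\langle z^{-1}\rangle$ takes the coefficient of $z^{-1}$. Its co-unit is the algebra homomorphism with $\varepsilon(a_n)=0$ for $n\ge1$. It is a graded connected Hopf algebra ($a_n$ of degree $n$). **The Hopf algebra $\widetilde{\mathcal{H}^{\alpha}}$.** Let $Y_n$ be the set of rooted planar binary trees with $n$ internal vertices, $Y_\infty=\bigcup_{n\ge0}Y_n$,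 and $|t|$ the number of internal vertices of $t$. The unique element of $Y_0$ (the root tree) is denoted $|$. For trees $r,s$, $r\vee s\in Y_{|r|+|s|+1}$ is the tree obtained by grafting $r$ (on the left) and $s$ (on the right) on a new root; put $V(t)=|\vee t$. The over product $t/s$ is the tree obtained by grafting the root of $t$ on the left-most leaf of $s$; it is associative with unit $|$. As a vector space $\widetilde{\mathcal{H}^{\alpha}}=\mathbb{C}Y_\infty$ is spanned by all trees; it is a unital algebra with the product $/$ and unit $|$, and it is graded by $|t|$ (it is a free algebra on the trees $V(t)$, $t\in Y_\infty$, and $r\vee s=r/V(s)$). The linear maps $\Delta^\alpha,\delta^\alpha:\widetilde{\mathcal{H}^{\alpha}}\to\widetilde{\mathcal{H}^{\alpha}}\otimes\widetilde{\mathcal{H}^{\alpha}}$ are defined recursively by $$\Delta^\alpha(|)=|\otimes|,\quad \Delta^\alpha V(r)=|\otimes V(r)+\delta^\alpha V(r),\quad \Delta^\alpha(r\vee s)=\Delta^\alpha(r)/\Delta^\alpha V(s),$$ $$\delta^\alpha(|)=|\otimes|,\quad \delta^\alpha V(r)=(V\otimes\mathrm{Id})\delta^\alpha(r),\quad \delta^\alpha(r\vee s)=\Delta^\alpha(r)/\delta^\alpha V(s),$$ where $V$ is extended linearly and $/$ on tensors is componentwise. The co-product is $\Delta^\alpha$, and the co-unit sends $|$ to $1$ and all other trees to $0$. It is known that $\widetilde{\mathcal{H}^{\alpha}}$ is a graded connected Hopf algebra with these structures. *)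

(* Defs.v *)
From HB Require Import structures.
From mathcomp Require Import all_boot all_order all_algebra.
From mathcomp Require Import finmap.
From mathcomp Require Import monalg.
From mathcomp Require Import complex reals.

Set Implicit Arguments.
Unset Strict Implicit.
Unset Printing Implicit Defensive.

Import GRing.Theory.
Local Open Scope ring_scope.

(* [{malg K[M]}] is the algebra of a monoid [M]: the free [K]-module on [M]
   with the bilinear extension of the product of [M].  The tensor product
   [{malg K[M]} (x) {malg K[N]}] is modelled as [{malg K[M * N]}], whose basis
   [<<(m, n)>>] stands for [m (x) n].  With the product monoid structure on
   [M * N], multiplication of tensors is componentwise. *)

Section ProductMonoid.
Variables M N : monomType.
Implicit Types x y z : (M * N)%type.

Definition pair_one : M * N := (mone, mone).
Definition pair_mul x y : M * N := (mmul x.1 y.1, mmul x.2 y.2).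

Lemma pair_mulA : associative pair_mul.
Proof. by move=> x y z; rewrite /pair_mul /= !mulmA. Qed.

Lemma pair_mul1m : left_id pair_one pair_mul.
Proof. by case=> x y; rewrite /pair_mul /= !mul1m. Qed.

Lemma pair_mulm1 : right_id pair_one pair_mul.
Proof. by case=> x y; rewrite /pair_mul /= !mulm1. Qed.

Lemma pair_unitm x y :
  pair_mul x y = pair_one -> x = pair_one /\ y = pair_one.
Proof.
by case: x y => [x1 x2] [y1 y2] [/unitm[/= -> ->] /unitm[/= -> ->]].
Qed.

HB.instance Definition _ := Choice_isMonomialDef.Build (M * N)%type
  pair_mulA pair_mul1m pair_mulm1 pair_unitm.
End ProductMonoid.

Section MonoidAlgebra.
Variables (K : comNzRingType) (M : monomType).

Lemma malgU_scale (k : K) (m : M) : << k *g m >> = k *: << m >>.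
Proof. by apply/malgP => n; rewrite mcoeffZ !mcoeffU mulr_natr. Qed.

Lemma malgU_mul (m n : M) :
  << m >> * << n >> = << mmul m n >> :> {malg K[M]}.
Proof. by rewrite malgM_def fgmulUU mulr1. Qed.

Lemma malg_sumU (u : {malg K[M]}) : u = \sum_(m <- msupp u) u@_m *: << m >>.
Proof. by rewrite {1}(monalgE u); apply: eq_bigr => m _; exact: malgU_scale. Qed.

(* Stated as a lemma: since [malg] is already declared an [algType] over
   commutative monoids, no instance can be added for general ones. *)
Lemma malg_scalerAr (k : K) (x y : {malg K[M]}) : k *: (x * y) = x * (k *: y).
Proof.
apply/malgP=> m; rewrite mcoeffZ.
rewrite (mcoeffMlw _ (fsubset_refl _) (msuppZ_le k y)).
rewrite (mcoeffMlw _ (fsubset_refl (msupp x)) (fsubset_refl (msupp y))) mulr_sumr.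
apply: eq_bigr => i _; rewrite mulr_sumr; apply: eq_bigr => j _.
by rewrite mcoeffZ mulrnAr mulrCA.
Qed.
End MonoidAlgebra.

Section LinearExtension.
Variables (K : comNzRingType) (M : choiceType) (V : lmodType K) (h : M -> V).

Definition linext (u : {malg K[M]}) : V := \sum_(m <- msupp u) u@_m *: h m.

Lemma linextEw (d : {fset M}) u :
  (msupp u `<=` d)%fset -> linext u = \sum_(m <- d) u@_m *: h m.
Proof.
move=> le_d; rewrite /linext (big_fset_incl _ le_d) // => m _ /mcoeff_outdom ->.
by rewrite scale0r.
Qed.

Fact linext_is_linear : linear linext.
Proof.
move=> k u v; pose d := (msupp u `|` (msupp v `|` msupp (k *: u + v)))%fset.
have du : (msupp u `<=` d)%fset by apply: fsubsetUl.
have dv : (msupp v `<=` d)%fset by rewrite fsubsetU // fsubsetUl orbT.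
have dw : (msupp (k *: u + v) `<=` d)%fset.
  by rewrite fsubsetU // fsubsetUr orbT.
rewrite (linextEw du) (linextEw dv) (linextEw dw).
rewrite scaler_sumr -big_split; apply: eq_bigr => m _ /=.
by rewrite mcoeffD mcoeffZ scalerDl scalerA.
Qed.

HB.instance Definition _ :=
  GRing.isLinear.Build K {malg K[M]} V *:%R linext linext_is_linear.

Lemma linextU m : linext << m >> = h m.
Proof. by rewrite /linext msuppU oner_eq0 big_seq_fset1 mcoeffUU scale1r. Qed.
End LinearExtension.

Section Tensor.
Variable K : comNzRingType.

Definition tens (M N : choiceType) (u : {malg K[M]}) (v : {malg K[N]}) :
    {malg K[(M * N)%type]} :=
  linext (fun m => linext (fun n => << (m, n) >>) v) u.

(* [tensmap f g] is [f (x) g], for linear maps [f] and [g]. *)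
Definition tensmap (M N M' N' : choiceType)
    (f : {malg K[M]} -> {malg K[M']}) (g : {malg K[N]} -> {malg K[N']}) :
    {malg K[(M * N)%type]} -> {malg K[(M' * N')%type]} :=
  linext (fun p => tens (f << p.1 >>) (g << p.2 >>)).

Definition tens_assoc (L M N : choiceType) :
    {malg K[((L * M) * N)%type]} -> {malg K[(L * (M * N))%type]} :=
  linext (fun p => << (p.1.1, (p.1.2, p.2)) >>).

Definition tens_mul (M : monomType) :
    {malg K[(M * M)%type]} -> {malg K[M]} :=
  linext (fun p => << mmul p.1 p.2 >>).

(* The contractions [eps (x) Id] and [Id (x) eps], landing in
   [K (x) H = H = H (x) K]. *)
Definition contractl (M : choiceType) (eps : {malg K[M]} -> K^o) :
    {malg K[(M * M)%type]} -> {malg K[M]} :=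
  linext (fun p => (eps << p.1 >> : K) *: << p.2 >>).

Definition contractr (M : choiceType) (eps : {malg K[M]} -> K^o) :
    {malg K[(M * M)%type]} -> {malg K[M]} :=
  linext (fun p => (eps << p.2 >> : K) *: << p.1 >>).
End Tensor.

Section HopfAlgebra.
Variables (K : comNzRingType) (M : monomType).
Notation H := {malg K[M]}.
Notation HH := {malg K[(M * M)%type]}.

Record is_hopf_algebra (Delta : {linear H -> HH}) (eps : {linear H -> K^o})
    (S : {linear H -> H}) : Prop := IsHopfAlgebra {
  comul_multiplicative : monoid_morphism Delta;
  counit_multiplicative : monoid_morphism eps;
  comul_coassociative :
    forall x, tens_assoc (tensmap Delta idfun (Delta x)) =
              tensmap idfun Delta (Delta x);
  counit_left : forall x, contractl eps (Delta x) = x;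
  counit_right : forall x, contractr eps (Delta x) = x;
  antipode_left :
    forall x, tens_mul (tensmap S idfun (Delta x)) = (eps x : K) *: 1;
  antipode_right :
    forall x, tens_mul (tensmap idfun S (Delta x)) = (eps x : K) *: 1 }.

(* [w] belongs to the image of [B (x) B] in [H (x) H]. *)
Definition in_tensor_square (B : H -> Prop) (w : HH) : Prop :=
  exists2 s : seq (H * H),
    (forall p, p \in s -> B p.1 /\ B p.2) & w = \sum_(p <- s) tens p.1 p.2.

Record is_hopf_subalgebra (Delta : {linear H -> HH}) (S : {linear H -> H})
    (B : H -> Prop) : Prop := IsHopfSubalgebra {
  hopf_sub1 : B 1;
  hopf_subM : forall x y, B x -> B y -> B (x * y);
  hopf_subZD : forall (k : K) x y, B x -> B y -> B (k *: x + y);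
  hopf_sub_comul : forall x, B x -> in_tensor_square B (Delta x);
  hopf_sub_antipode : forall x, B x -> B (S x) }.

End HopfAlgebra.

Definition is_coalgebra_morphism (K : comNzRingType) (M N : monomType)
    (DeltaM : {malg K[M]} -> {malg K[(M * M)%type]}) (epsM : {malg K[M]} -> K^o)
    (DeltaN : {malg K[N]} -> {malg K[(N * N)%type]}) (epsN : {malg K[N]} -> K^o)
    (f : {linear {malg K[M]} -> {malg K[N]}}) : Prop :=
  (forall x, DeltaN (f x) = tensmap f f (DeltaM x)) /\
  (forall x, epsN (f x) = epsM x).

(* The free monoid [{fmonom nat}] has generators [fmu i] indexed from 0;
   [fmu i] is the variable [a_(i+1)]. *)
Notation Hdif K := {malg K[{fmonom nat}]}.

Section FreeAlgebra.
Variables (K : comNzRingType) (A : lalgType K) (g : nat -> A).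

Definition free_word (m : {fmonom nat}) : A := \prod_(i <- (m : seq nat)) g i.

Definition free_lift : Hdif K -> A := linext free_word.

HB.instance Definition _ := GRing.Linear.on free_lift.

Lemma free_lift_is_monoid_morphism :
  (forall (k : K) (x y : A), k *: (x * y) = x * (k *: y)) ->
  monoid_morphism free_lift.
Proof.
move=> scalerAr; split=> [|u v].
  by rewrite /free_lift linextU /free_word fm1 big_nil.
have liftU m : free_lift << m >> = free_word m by exact: linextU.
have liftUM m v' : free_lift (<< m >> * v') = free_word m * free_lift v'.
  rewrite [in LHS](malg_sumU v') mulr_sumr [LHS]linear_sum mulr_sumr.
  apply: eq_bigr => n _; rewrite -malg_scalerAr malgU_mul [LHS]linearZ.
  by rewrite /= liftU /free_word fmM big_cat /= scalerAr.
rewrite [in LHS](malg_sumU u) mulr_suml [LHS]linear_sum mulr_suml.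
apply: eq_bigr => m _; rewrite -scalerAl [LHS]linearZ /= liftUM.
by rewrite scalerAl.
Qed.

Lemma free_lift_gen i : free_lift << fmu i >> = g i.
Proof. by rewrite /free_lift linextU /free_word fmuE big_seq1. Qed.
End FreeAlgebra.

Section FaaDiBruno.
Variable K : comNzRingType.

Definition a (n : nat) : Hdif K := if n is i.+1 then << fmu i >> else 1.

(* Coefficient of [x^n] in [A(x) = \sum_n a_n x^(n+1)]. *)
Definition A_coef (n : nat) : Hdif K := if n is m.+1 then a m else 0.

(* [A(x)] modulo [x^n]. *)
Definition A_trunc (n : nat) : {poly Hdif K} := \poly_(i < n) A_coef i.

(* Coefficient of [x^(n+1)] in [<z^-1> A(z) (x) \sum_k A(x)^k z^(-k-1)]:
   the residue pairs the coefficient of [z^k] in [A(z)] with [A(x)^k].  The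
   powers with [k > n+1] do not contribute since [A(x)] is divisible by [x],
   and truncating [A(x)] modulo [x^(n+2)] does not affect the coefficient of
   [x^(n+1)]. *)
Definition Ddif_coef (n : nat) : {malg K[({fmonom nat} * {fmonom nat})%type]} :=
  \sum_(k < n.+2) tens (A_coef k) (A_trunc n.+2 ^+ k)`_n.+1.

Definition Ddif := free_lift (fun i => Ddif_coef i.+1).
HB.instance Definition _ := GRing.Linear.on Ddif.
HB.instance Definition _ := GRing.isMonoidMorphism.Build _ _ Ddif
  (free_lift_is_monoid_morphism _ (@malg_scalerAr K _)).

Definition epsdif := free_lift (fun=> 0 : K^o).
HB.instance Definition _ := GRing.Linear.on epsdif.
HB.instance Definition _ := GRing.isMonoidMorphism.Build _ _ epsdif
  (free_lift_is_monoid_morphism _ (@scalerAr K K^o)).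
End FaaDiBruno.

Inductive bintree := Leaf | Node of bintree & bintree.

Fixpoint bintree_encode t : GenTree.tree unit :=
  if t is Node r s then GenTree.Node 0 [:: bintree_encode r; bintree_encode s]
  else GenTree.Leaf tt.

Fixpoint bintree_decode (c : GenTree.tree unit) : bintree :=
  if c is GenTree.Node _ [:: r; s] then
    Node (bintree_decode r) (bintree_decode s)
  else Leaf.

Lemma bintree_encodeK : cancel bintree_encode bintree_decode.
Proof. by elim=> //= r -> s ->. Qed.

HB.instance Definition _ := Countable.copy bintree (can_type bintree_encodeK).

Fixpoint nodes t : nat := if t is Node r s then (nodes r + nodes s).+1 else 0.

Definition V (t : bintree) : bintree := Node Leaf t.

(* [over t s] is [t / s]. *)
Fixpoint over (t s : bintree) : bintree :=
  if s is Node l r then Node (over t l) r else t.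

Lemma overA : associative over.
Proof. by move=> t s; elim=> //= l -> r. Qed.

Lemma over_leafl : left_id Leaf over.
Proof. by elim=> //= l -> r. Qed.

Lemma over_leafr : right_id Leaf over.
Proof. by []. Qed.

Lemma over_eq_leaf t s : over t s = Leaf -> t = Leaf /\ s = Leaf.
Proof. by case: s. Qed.

HB.instance Definition _ := Choice_isMonomialDef.Build bintree
  overA over_leafl over_leafr over_eq_leaf.

Lemma over_V r s : over r (V s) = Node r s.
Proof. by []. Qed.

(* Trees of height at most [h]; a tree with [n] nodes has height at most [n],
   so [trees n] enumerates all of Y_n. *)
Fixpoint trees_upto (h : nat) : seq bintree :=
  if h is h'.+1 then
    Leaf :: [seq Node r s | r <- trees_upto h', s <- trees_upto h']
  else [:: Leaf].

Definition trees (n : nat) : seq bintree :=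
  [seq t <- trees_upto n | nodes t == n].

Lemma trees_upto_uniq h : uniq (trees_upto h).
Proof.
elim: h => //= h IHh; apply/andP; split; first by apply/allpairsP => -[[]] ? ? [].
by apply: allpairs_uniq => // -[r s] [r' s'] _ _ [-> ->].
Qed.

Lemma mem_trees_upto t h : (nodes t <= h)%N -> t \in trees_upto h.
Proof.
elim: t h => [|r IHr s IHs] [|h] //=; rewrite ltnS => le_h.
rewrite inE /=; apply: allpairs_f; [apply: IHr | apply: IHs];
  by apply: leq_trans le_h; rewrite ?leq_addr ?leq_addl.
Qed.

Lemma trees_uniq n : uniq (trees n).
Proof. by rewrite filter_uniq // trees_upto_uniq. Qed.

Lemma mem_trees n t : (t \in trees n) = (nodes t == n).
Proof.
by rewrite mem_filter andb_idr // => /eqP <-; apply: mem_trees_upto.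
Qed.

Notation Halpha K := {malg K[bintree]}.

Section TreeHopf.
Variable K : comNzRingType.
Notation HH := {malg K[(bintree * bintree)%type]}.

Definition Vlin : Halpha K -> Halpha K := linext (fun t => << V t >>).

Definition VxId : HH -> HH := tensmap Vlin idfun.

Fixpoint Dalpha_tree (t : bintree) : HH :=
  if t is Node r s then
    Dalpha_tree r * (<< (Leaf, V s) >> + VxId (dalpha_tree s))
  else << (Leaf, Leaf) >>
with dalpha_tree (t : bintree) : HH :=
  if t is Node r s then Dalpha_tree r * VxId (dalpha_tree s)
  else << (Leaf, Leaf) >>.

Lemma one_leaf : << (Leaf, Leaf) >> = 1 :> HH.
Proof. by []. Qed.

Lemma dalpha_tree_V r : dalpha_tree (V r) = VxId (dalpha_tree r).
Proof. by rewrite /= one_leaf mul1r. Qed.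

Lemma dalpha_tree_Node r s :
  dalpha_tree (Node r s) = Dalpha_tree r * dalpha_tree (V s).
Proof. by rewrite dalpha_tree_V. Qed.

Lemma Dalpha_tree_V r :
  Dalpha_tree (V r) = << (Leaf, V r) >> + dalpha_tree (V r).
Proof. by rewrite dalpha_tree_V /= one_leaf mul1r. Qed.

Lemma Dalpha_tree_Node r s :
  Dalpha_tree (Node r s) = Dalpha_tree r * Dalpha_tree (V s).
Proof. by rewrite Dalpha_tree_V dalpha_tree_V. Qed.

Definition Dalpha : Halpha K -> HH := linext Dalpha_tree.
HB.instance Definition _ := GRing.Linear.on Dalpha.

Definition epsalpha : Halpha K -> K^o := linext (fun t => (t == Leaf)%:R).
HB.instance Definition _ := GRing.Linear.on epsalpha.

Definition tree_sum (n : nat) : Halpha K := \sum_(t <- trees n) << t >>.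

Definition Omega : Hdif K -> Halpha K := free_lift (fun i => tree_sum i.+1).
HB.instance Definition _ := GRing.Linear.on Omega.
HB.instance Definition _ := GRing.isMonoidMorphism.Build _ _ Omega
  (free_lift_is_monoid_morphism _ (@malg_scalerAr K _)).

Lemma Omega_a n : (0 < n)%N -> Omega (a K n) = tree_sum n.
Proof. by case: n => // n _; apply: free_lift_gen. Qed.
End TreeHopf.

Arguments Ddif K _ : clear implicits.
Arguments epsdif K _ : clear implicits.
Arguments Dalpha K _ : clear implicits.
Arguments epsalpha K _ : clear implicits.
Arguments Omega K _ : clear implicits.

(* Main.v *)
Require Import Defs.
From HB Require Import structures.
From mathcomp Require Import all_boot all_order all_algebra.
From mathcomp Require Import finmap monalg complex reals.

Import GRing.Theory.
Local Open Scope ring_scope.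

(** Write [T n] for the sum of the trees with [n] nodes, i.e. the image of
    [a_n], and [d] for the auxiliary map delta^alpha.

    Coalgebra morphism.  A tree with [n+1] nodes is [r \/ s = r / V s] for a
    unique pair of trees with [n] nodes in total, so
    [T (n+1) = \sum_(i+j=n) T i / V (T j)] ([tsumS]).  Put
    [u(x) = \sum_n T n x^(n+1)].  The recursive definitions of the coproduct and
    of [d] turn this into
      [Delta (T n) = \sum_(i+j=n) d (T i) / (1 (x) T j)]
    and [d (T (n+1)) = \sum_(i+j=n) Delta (T i) / (V (x) Id) (d (T j))].
    The unique solution is
      [d (T n) = \sum_k T k (x) <x^n> u^k] and
      [Delta (T n) = \sum_k T k (x) <x^(n+1)> u^(k+1)]
    ([dalpha_residue], [Dalpha_residue]), and the second formula is the image of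
    the residue that defines the coproduct of [a_n].

    Injectivity.  The algebra of trees is free on the elements [V t].  Send
    [V t] to an element [b_(n+1)] when [t] is the right comb with [n] nodes and to
    0 otherwise.  The recursion for [T] shows that [T n] is sent to [a_n]
    provided that [a_(n+1) = \sum_(i+j=n) a_i b_(j+1)], which can be solved for
    [b] because [a_0 = 1].  So Omega has an algebra retraction ([OmegaK]).

    Hopf structures.  Coassociativity on trees is a simultaneous induction with
    the coaction law [(d (x) Id) d = (Id (x) Delta) d].  A connected graded
    bialgebra has the antipode [\sum_k (eta eps - Id)^{*k}], a sum that is finite
    on each homogeneous component.  As Omega is injective, multiplicative,
    comultiplicative and homogeneous, the coalgebra and antipode axioms of the
    source follow from those of the target, and Omega commutes with the
    antipodes. *)

Set Implicit Arguments.
Unset Strict Implicit.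
Unset Printing Implicit Defensive.

(** Unifying two distinct products of a monoid algebra unfolds both of them, at
    great cost.  This variant tries reflexivity before it looks at the
    hypotheses, which are often equations between such products. *)
Ltac done :=
  solve [ match goal with |- _ = _ => reflexivity end
        | trivial; hnf; intros; solve
          [ do ![solve [trivial | apply: sym_equal; trivial]
               | discriminate | contradiction | split]
          | match goal with H : ~ _ |- _ => solve [case H; trivial] end ]].

(** * Linear extensionality and locked tensor operations *)

Lemma malg_lin_ind (K : comNzRingType) (M : choiceType)
    (P : {malg K[M]} -> Prop) :
  P 0 -> (forall k u v, P u -> P v -> P (k *: u + v)) ->
  (forall m, P << m >>) -> forall u, P u.
Proof.
move=> P0 PD PU u; have -> : u = \sum_(m <- msupp u) u@_m *: << m >>.
  rewrite {1}(monalgE u); apply: eq_bigr => m _; apply/malgP => n.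
  by rewrite mcoeffZ !mcoeffU mulr_natr.
by elim/big_rec: _ => // m v _; apply: PD.
Qed.

(** The two locked constants keep unification from unfolding the sums behind
    tensors; [tensE] and unlocking lead back to [tens] and [tensmap]. *)
HB.lock Definition otimes (K : comNzRingType) (M N : choiceType)
  (u : {malg K[M]}) (v : {malg K[N]}) : {malg K[(M * N)%type]} := tens u v.

HB.lock Definition tmap (K : comNzRingType) (M N M' N' : choiceType)
  (f : {malg K[M]} -> {malg K[M']}) (g : {malg K[N]} -> {malg K[N']}) :
  {malg K[(M * N)%type]} -> {malg K[(M' * N')%type]} := tensmap f g.

Notation "u ⊗ v" := (otimes u v) (at level 40, left associativity).

Section TensorCalculus.
Variable K : comNzRingType.

Lemma malg_lin_eq (M : choiceType) (W : lmodType K) (f g : {malg K[M]} -> W) :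
  linear f -> linear g -> (forall m, f << m >> = g << m >>) ->
  forall u, f u = g u.
Proof.
move=> fL gL eqfg.
have L0 h : linear h -> h (0 : {malg K[M]}) = 0 :> W.
  by move=> /(_ (-1) 0 0); rewrite !scaleN1r !addNr.
elim/malg_lin_ind => [|k u v IHu IHv|]; first by rewrite !L0.
  by rewrite fL gL IHu IHv.
exact: eqfg.
Qed.

Section Maps.
Variables (M N M' N' : choiceType).
HB.instance Definition _ := GRing.Linear.on (@tens_assoc K M N M').
HB.instance Definition _ (eps : {malg K[M]} -> K^o) :=
  GRing.Linear.on (contractl eps).
HB.instance Definition _ (eps : {malg K[M]} -> K^o) :=
  GRing.Linear.on (contractr eps).

Lemma tmapP (f : {malg K[M]} -> {malg K[M']})
    (g : {malg K[N]} -> {malg K[N']}) : linear (tmap f g).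
Proof. by rewrite tmap.unlock; exact: linearP. Qed.

Lemma tmapD (f : {malg K[M]} -> {malg K[M']}) (g : {malg K[N]} -> {malg K[N']})
  w w' : tmap f g (w + w') = tmap f g w + tmap f g w'.
Proof. by rewrite tmap.unlock; exact: linearD. Qed.

HB.instance Definition _ (f : {malg K[M]} -> {malg K[M']})
    (g : {malg K[N]} -> {malg K[N']}) :=
  GRing.isLinear.Build K {malg K[(M * N)%type]} {malg K[(M' * N')%type]} *:%R
    (tmap f g) (tmapP f g).
End Maps.
HB.instance Definition _ (M : monomType) := GRing.Linear.on (@tens_mul K M).

Lemma tens_assocP (L M N : choiceType) : linear (@tens_assoc K L M N).
Proof. exact: linearP. Qed.

Lemma tens_assocD (L M N : choiceType) w w' :
  @tens_assoc K L M N (w + w') = tens_assoc w + tens_assoc w'.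
Proof. exact: linearD. Qed.

Lemma tens_mulP (M : monomType) : linear (@tens_mul K M).
Proof. exact: linearP. Qed.

Lemma contractlP (M : choiceType) (eps : {malg K[M]} -> K^o) :
  linear (contractl eps).
Proof. exact: linearP. Qed.

Lemma contractrP (M : choiceType) (eps : {malg K[M]} -> K^o) :
  linear (contractr eps).
Proof. exact: linearP. Qed.

Lemma contractlD (M : choiceType) (eps : {malg K[M]} -> K^o) w w' :
  contractl eps (w + w') = contractl eps w + contractl eps w'.
Proof. exact: linearD. Qed.

Lemma contractrD (M : choiceType) (eps : {malg K[M]} -> K^o) w w' :
  contractr eps (w + w') = contractr eps w + contractr eps w'.
Proof. exact: linearD. Qed.

(** * Tensor products of monoid algebras *)

Section Otimes.
Variables (M N : choiceType).
Implicit Types (u : {malg K[M]}) (v : {malg K[N]}).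

Lemma tensE u v : tens u v = u ⊗ v.
Proof. by rewrite otimes.unlock. Qed.

Lemma otimesPl k u1 u2 v : (k *: u1 + u2) ⊗ v = k *: (u1 ⊗ v) + u2 ⊗ v.
Proof. by rewrite otimes.unlock; exact: linearP. Qed.

Lemma otimesUl m v :
  << m >> ⊗ v = linext (fun n => << (m, n) >>) v :> {malg K[(M * N)%type]}.
Proof. by rewrite otimes.unlock; exact: linextU. Qed.

Lemma otimesUU m n :
  << m >> ⊗ << n >> = << (m, n) >> :> {malg K[(M * N)%type]}.
Proof. by rewrite otimesUl linextU. Qed.

Lemma otimesPr k u v1 v2 : u ⊗ (k *: v1 + v2) = k *: (u ⊗ v1) + u ⊗ v2.
Proof.
move: u; apply: malg_lin_eq => [c x y|c x y|m]; last by rewrite !otimesUl linearP.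
  exact: otimesPl.
rewrite !otimesPl !scalerDr !scalerA [k * c]mulrC; exact: addrACA.
Qed.

HB.instance Definition _ u :=
  GRing.isLinear.Build K {malg K[N]} {malg K[(M * N)%type]} *:%R
    (@otimes K M N u) (fun k => otimesPr k u).

(** The first argument of [⊗] comes last here, so that linearity in it can be
    declared. *)
Definition otimesl v u : {malg K[(M * N)%type]} := u ⊗ v.
HB.instance Definition _ v := GRing.isLinear.Build K {malg K[M]}
  {malg K[(M * N)%type]} *:%R (otimesl v) (fun k u1 u2 => otimesPl k u1 u2 v).

Lemma otimes_suml I (r : seq I) (P : pred I) (F : I -> {malg K[M]}) v :
  (\sum_(i <- r | P i) F i) ⊗ v = \sum_(i <- r | P i) F i ⊗ v.
Proof. exact: (linear_sum (otimesl v)). Qed.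

Lemma otimes_sumr I (r : seq I) (P : pred I) (F : I -> {malg K[N]}) u :
  u ⊗ (\sum_(i <- r | P i) F i) = \sum_(i <- r | P i) u ⊗ F i.
Proof. exact: linear_sum. Qed.

Lemma otimes0l v : (0 : {malg K[M]}) ⊗ v = 0.
Proof. exact: (linear0 (otimesl v)). Qed.

Lemma otimes0r u : u ⊗ (0 : {malg K[N]}) = 0.
Proof. exact: linear0. Qed.

Lemma otimesZl k u v : (k *: u) ⊗ v = k *: (u ⊗ v).
Proof. exact: (linearZ_LR (otimesl v)). Qed.

Lemma otimesDl u1 u2 v : (u1 + u2) ⊗ v = u1 ⊗ v + u2 ⊗ v.
Proof. exact: (linearD (otimesl v)). Qed.

Lemma otimesDr u v1 v2 : u ⊗ (v1 + v2) = u ⊗ v1 + u ⊗ v2.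
Proof. exact: linearD. Qed.

Lemma otimes_lin_eq (W : lmodType K) (f g : {malg K[(M * N)%type]} -> W) :
  linear f -> linear g -> (forall u v, f (u ⊗ v) = g (u ⊗ v)) ->
  forall w, f w = g w.
Proof.
by move=> fL gL eqfg; apply: malg_lin_eq => // -[m n]; rewrite -otimesUU.
Qed.
End Otimes.

Section OtimesMul.
Variables M N : monomType.

Lemma malgPM k (x y z : {malg K[M]}) :
  (k *: x + y) * z = k *: (x * z) + y * z.
Proof. by rewrite mulrDl scalerAl. Qed.

Lemma malgMP k (x y z : {malg K[M]}) :
  z * (k *: x + y) = k *: (z * x) + z * y.
Proof. by rewrite mulrDr malg_scalerAr. Qed.
End OtimesMul.

Lemma otimesM (M N : monomType) (u u' : {malg K[M]}) (v v' : {malg K[N]}) :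
  (u ⊗ v) * (u' ⊗ v') = (u * u') ⊗ (v * v').
Proof.
move: u; apply: malg_lin_eq => [k x y|k x y|m].
- by rewrite otimesPl malgPM.
- by rewrite malgPM otimesPl.
move: u'; apply: malg_lin_eq => [k x y|k x y|m'].
- by rewrite otimesPl malgMP.
- by rewrite malgMP otimesPl.
move: v; apply: malg_lin_eq => [k x y|k x y|n].
- by rewrite otimesPr malgPM.
- by rewrite malgPM otimesPr.
move: v'; apply: malg_lin_eq => [k x y|k x y|n'].
- by rewrite otimesPr malgMP.
- by rewrite malgMP otimesPr.
by rewrite !malgU_mul !otimesUU malgU_mul.
Qed.

Lemma otimes11 (M N : monomType) :
  (1 : {malg K[M]}) ⊗ (1 : {malg K[N]}) = 1.
Proof. exact: otimesUU. Qed.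

Lemma tmapE (M N M' N' : choiceType)
    (f : {linear {malg K[M]} -> {malg K[M']}})
    (g : {linear {malg K[N]} -> {malg K[N']}}) u v :
  tmap f g (u ⊗ v) = f u ⊗ g v.
Proof.
move: u; apply: malg_lin_eq => [k x y|k x y|m].
- by rewrite otimesPl tmapP.
- by rewrite linearP otimesPl.
move: v; apply: malg_lin_eq => [k x y|k x y|n].
- by rewrite otimesPr tmapP.
- by rewrite linearP otimesPr.
by rewrite otimesUU tmap.unlock [LHS]linextU otimes.unlock.
Qed.

Lemma tmap_ext (M N M' N' : choiceType) (f f' : {malg K[M]} -> {malg K[M']})
    (g g' : {malg K[N]} -> {malg K[N']}) :
  f =1 f' -> g =1 g' -> tmap f g =1 tmap f' g'.
Proof.
move=> eqf eqg w; rewrite tmap.unlock.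
by apply: eq_bigr => p _; rewrite eqf eqg.
Qed.

Lemma tmap_id (M N : choiceType) (w : {malg K[(M * N)%type]}) :
  tmap idfun idfun w = w.
Proof.
move: w; apply: otimes_lin_eq => [|//|u v]; first exact: tmapP.
by rewrite tmapE.
Qed.

Lemma tmap_comp (M N M' N' M'' N'' : choiceType)
    (f : {linear {malg K[M]} -> {malg K[M']}})
    (g : {linear {malg K[N]} -> {malg K[N']}})
    (f' : {linear {malg K[M']} -> {malg K[M'']}})
    (g' : {linear {malg K[N']} -> {malg K[N'']}}) w :
  tmap f' g' (tmap f g w) = tmap (f' \o f) (g' \o g) w.
Proof.
move: w; apply: otimes_lin_eq => [k x y|k x y|u v].
- by rewrite !tmapP.
- by rewrite tmapP.
by rewrite !tmapE.
Qed.

Lemma tmapM (M N M' N' : monomType)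
    (f : {linear {malg K[M]} -> {malg K[M']}})
    (g : {linear {malg K[N]} -> {malg K[N']}}) :
  {morph f : x y / x * y} -> {morph g : x y / x * y} ->
  {morph tmap f g : x y / x * y}.
Proof.
move=> fM gM w w'; move: w; apply: otimes_lin_eq => [k x y|k x y|u v].
- by rewrite malgPM tmapP.
- by rewrite tmapP malgPM.
move: w'; apply: otimes_lin_eq => [k x y|k x y|u' v'].
- by rewrite malgMP tmapP.
- by rewrite tmapP malgMP.
by rewrite otimesM !tmapE otimesM fM gM.
Qed.

Lemma idfunM (M : monomType) :
  {morph (idfun : {linear {malg K[M]} -> {malg K[M]}}) : x y / x * y}.
Proof. by []. Qed.

Lemma tens_assocE (L M N : choiceType) (u : {malg K[L]}) (v : {malg K[M]})
    (w : {malg K[N]}) : tens_assoc (u ⊗ v ⊗ w) = u ⊗ (v ⊗ w).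
Proof.
move: u; apply: malg_lin_eq => [k x y|k x y|l].
- by rewrite !otimesPl tens_assocP.
- by rewrite otimesPl.
move: v; apply: malg_lin_eq => [k x y|k x y|m].
- by rewrite otimesPr otimesPl tens_assocP.
- by rewrite otimesPl otimesPr.
move: w; apply: malg_lin_eq => [k x y|k x y|n].
- by rewrite otimesPr tens_assocP.
- by rewrite !otimesPr.
by rewrite !otimesUU [LHS]linextU.
Qed.

Lemma otimes3_lin_eq (L M N : choiceType) (W : lmodType K)
    (f g : {malg K[((L * M) * N)%type]} -> W) :
  linear f -> linear g ->
  (forall u v w, f (u ⊗ v ⊗ w) = g (u ⊗ v ⊗ w)) -> forall w, f w = g w.
Proof.
move=> fL gL eqfg; apply: malg_lin_eq => // -[[l m] n].
by rewrite -!otimesUU.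
Qed.

Lemma tens_assocM (L M N : monomType) :
  {morph @tens_assoc K L M N : x y / x * y}.
Proof.
move=> w w'; move: w; apply: otimes3_lin_eq => [k x y|k x y|u v t].
- by rewrite malgPM tens_assocP.
- by rewrite tens_assocP malgPM.
move: w'; apply: otimes3_lin_eq => [k x y|k x y|u' v' t'].
- by rewrite malgMP tens_assocP.
- by rewrite tens_assocP malgMP.
by rewrite !otimesM !tens_assocE !otimesM.
Qed.

Lemma tens_assoc_tmap (L M N L' M' N' : choiceType)
    (f : {linear {malg K[L]} -> {malg K[L']}})
    (g : {linear {malg K[M]} -> {malg K[M']}})
    (h : {linear {malg K[N]} -> {malg K[N']}}) w :
  tens_assoc (tmap (tmap f g) h w) = tmap f (tmap g h) (tens_assoc w).
Proof.
move: w; apply: otimes3_lin_eq => [k x y|k x y|u v t].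
- by rewrite tmapP tens_assocP.
- by rewrite tens_assocP tmapP.
by rewrite tens_assocE !tmapE /= !tmapE tens_assocE.
Qed.

Lemma tens_mulE (M : monomType) (u v : {malg K[M]}) :
  tens_mul (u ⊗ v) = u * v.
Proof.
move: u; apply: malg_lin_eq => [k x y|k x y|m].
- by rewrite otimesPl tens_mulP.
- by rewrite malgPM.
move: v; apply: malg_lin_eq => [k x y|k x y|n].
- by rewrite otimesPr tens_mulP.
- by rewrite malgMP.
by rewrite otimesUU malgU_mul [LHS]linextU.
Qed.

Lemma tens_mul_tmap (M N : monomType)
    (f : {linear {malg K[M]} -> {malg K[N]}}) w :
  {morph f : x y / x * y} -> tens_mul (tmap f f w) = f (tens_mul w).
Proof.
move=> fM; move: w; apply: otimes_lin_eq => [k x y|k x y|u v].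
- by rewrite tmapP tens_mulP.
- by rewrite tens_mulP linearP.
by rewrite tmapE !tens_mulE fM.
Qed.

Lemma contractlE (M : choiceType) (eps : {linear {malg K[M]} -> K^o})
    (u v : {malg K[M]}) : contractl eps (u ⊗ v) = (eps u : K) *: v.
Proof.
move: u; apply: malg_lin_eq => [k x y|k x y|m].
- by rewrite otimesPl contractlP.
- by rewrite linearP scalerDl scalerA.
move: v; apply: malg_lin_eq => [k x y|k x y|n].
- by rewrite otimesPr contractlP.
- by rewrite scalerDr !scalerA mulrC.
by rewrite otimesUU [LHS]linextU.
Qed.

Lemma contractrE (M : choiceType) (eps : {linear {malg K[M]} -> K^o})
    (u v : {malg K[M]}) : contractr eps (u ⊗ v) = (eps v : K) *: u.
Proof.
move: v; apply: malg_lin_eq => [k x y|k x y|n].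
- by rewrite otimesPr contractrP.
- by rewrite linearP scalerDl scalerA.
move: u; apply: malg_lin_eq => [k x y|k x y|m].
- by rewrite otimesPl contractrP.
- by rewrite scalerDr !scalerA mulrC.
by rewrite otimesUU [LHS]linextU.
Qed.
End TensorCalculus.

(** * The coalgebra of trees *)

Section TreeCoalgebra.
Variable K : comNzRingType.
Notation H := (Halpha K).

HB.instance Definition _ := GRing.Linear.on (@Vlin K).

Definition dalpha : H -> {malg K[(bintree * bintree)%type]} :=
  linext (dalpha_tree K).
HB.instance Definition _ := GRing.Linear.on dalpha.

Lemma VlinP : linear (@Vlin K).
Proof. exact: linearP. Qed.

Lemma DalphaP : linear (Dalpha K).
Proof. exact: linearP. Qed.

Lemma dalphaP : linear dalpha.
Proof. exact: linearP. Qed.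

Lemma VlinU t : Vlin << t >> = << V t >> :> H.
Proof. exact: linextU. Qed.

Lemma DalphaU t : Dalpha K << t >> = Dalpha_tree K t.
Proof. exact: linextU. Qed.

Lemma dalphaU t : dalpha << t >> = dalpha_tree K t.
Proof. exact: linextU. Qed.

Lemma Dalpha1 : Dalpha K 1 = 1.
Proof. exact: (DalphaU Leaf). Qed.

Lemma dalpha1 : dalpha 1 = 1.
Proof. exact: (dalphaU Leaf). Qed.

Lemma mul_treeV r s : << r >> * Vlin << s >> = << Node r s >> :> H.
Proof. by rewrite VlinU malgU_mul. Qed.

(** Induction along the decomposition [r \/ s = r / V s], stated for arbitrary
    elements so that the steps are computations in the algebra. *)
Lemma tree_mulV_ind (P : H -> Prop) :
  P 1 -> (forall x y, P x -> P y -> P (x * Vlin y)) -> forall t, P << t >>.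
Proof.
move=> P1 PV; elim=> [|r Pr s Ps]; first exact: P1.
by rewrite -mul_treeV; exact: PV.
Qed.

Lemma alpha_lin_eq (W : lmodType K) (f g : H -> W) :
  linear f -> linear g -> f 1 = g 1 ->
  (forall x y, f x = g x -> f y = g y -> f (x * Vlin y) = g (x * Vlin y)) ->
  forall x, f x = g x.
Proof.
move=> fL gL fg1 fgV; apply: malg_lin_eq => //.
exact: (tree_mulV_ind (P := fun x => f x = g x)).
Qed.

Lemma dalpha_mulV (x y : H) :
  dalpha (x * Vlin y) = Dalpha K x * tmap (@Vlin K) idfun (dalpha y).
Proof.
move: x; apply: malg_lin_eq => [k x x'|k x x'|r].
- by rewrite malgPM dalphaP.
- by rewrite DalphaP malgPM.
move: y; apply: malg_lin_eq => [k y y'|k y y'|s].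
- by rewrite VlinP malgMP dalphaP.
- by rewrite dalphaP tmapP malgMP.
by rewrite mul_treeV !dalphaU DalphaU tmap.unlock.
Qed.

(** This is the coproduct of [V y]; see [Dalpha_Vlin]. *)
Definition DalphaV (y : H) : {malg K[(bintree * bintree)%type]} :=
  1 ⊗ Vlin y + tmap (@Vlin K) idfun (dalpha y).

Lemma DalphaVP : linear DalphaV.
Proof.
move=> k y y'; rewrite /DalphaV VlinP otimesPr dalphaP tmapP scalerDr.
exact: addrACA.
Qed.

Lemma Dalpha_mulV (x y : H) :
  Dalpha K (x * Vlin y) = Dalpha K x * DalphaV y.
Proof.
move: x; apply: malg_lin_eq => [k x x'|k x x'|r].
- by rewrite malgPM DalphaP.
- by rewrite DalphaP malgPM.
move: y; apply: malg_lin_eq => [k y y'|k y y'|s].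
- by rewrite VlinP malgMP DalphaP.
- by rewrite DalphaVP malgMP.
rewrite mul_treeV !DalphaU /DalphaV VlinU dalphaU otimesUU tmap.unlock.
reflexivity.
Qed.

Lemma Dalpha_Vlin y : Dalpha K (Vlin y) = DalphaV y.
Proof. by rewrite -[Vlin y]mul1r Dalpha_mulV Dalpha1 mul1r. Qed.

Lemma DalphaM : {morph Dalpha K : x y / x * y}.
Proof.
move=> x y; move: y; apply: alpha_lin_eq => [k y y'|k y y'||y z IHy _].
- by rewrite malgMP DalphaP.
- by rewrite DalphaP malgMP.
- by rewrite mulr1 Dalpha1 mulr1.
by rewrite mulrA [LHS]Dalpha_mulV [X in _ = _ * X](Dalpha_mulV y) IHy mulrA.
Qed.

(** [d] is left linear over the coproduct on products [x / V y], so that on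
    [w / (V (x) Id) w'] the map [d (x) Id] splits with a coproduct on the left
    factor only. *)
Lemma tmap_dalpha_mulV (w w' : {malg K[(bintree * bintree)%type]}) :
  tmap dalpha idfun (w * tmap (@Vlin K) idfun w') =
    tmap (Dalpha K) idfun w
      * tmap (tmap (@Vlin K) idfun) idfun (tmap dalpha idfun w').
Proof.
move: w; apply: otimes_lin_eq => [k x y|k x y|u v].
- by rewrite malgPM [LHS]tmapP.
- by rewrite [X in X * _]tmapP malgPM.
move: w'; apply: otimes_lin_eq => [k x y|k x y|u' v'].
- by rewrite tmapP malgMP [LHS]tmapP.
- rewrite [X in _ * tmap _ _ X = _]tmapP [X in _ * X = _]tmapP malgMP.
  reflexivity.
rewrite [X in _ = X * _]tmapE [X in _ = _ * tmap _ _ X]tmapE.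
rewrite [X in _ = _ * X]tmapE [X in tmap _ _ (_ * X) = _]tmapE.
by rewrite [in LHS]otimesM [LHS]tmapE /= dalpha_mulV otimesM.
Qed.

Lemma tmap_Vlin_Dalpha (w : {malg K[(bintree * bintree)%type]}) :
  tmap idfun (Dalpha K) (tmap (@Vlin K) idfun w) =
    tmap (@Vlin K) idfun (tmap idfun (Dalpha K) w).
Proof. by rewrite [LHS]tmap_comp [RHS]tmap_comp. Qed.

Lemma tmap_Dalpha_mulV (w w' : {malg K[(bintree * bintree)%type]}) :
  tmap idfun (Dalpha K) (w * tmap (@Vlin K) idfun w') =
    tmap idfun (Dalpha K) w * tmap (@Vlin K) idfun (tmap idfun (Dalpha K) w').
Proof.
by rewrite (tmapM (@idfunM K _) DalphaM) tmap_Vlin_Dalpha.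
Qed.

Lemma tens_assoc_Vlin (w : {malg K[((bintree * bintree) * bintree)%type]}) :
  tens_assoc (tmap (tmap (@Vlin K) idfun) idfun w) =
    tmap (@Vlin K) idfun (tens_assoc w).
Proof.
rewrite tens_assoc_tmap; apply: tmap_ext => // u; exact: tmap_id.
Qed.

Lemma tmap_Dalpha_Vlin (w : {malg K[(bintree * bintree)%type]}) :
  tens_assoc (tmap (Dalpha K) idfun (tmap (@Vlin K) idfun w)) =
    1 ⊗ tmap (@Vlin K) idfun w
      + tmap (@Vlin K) idfun (tens_assoc (tmap dalpha idfun w)).
Proof.
rewrite -tens_assoc_Vlin.
move: w; apply: otimes_lin_eq => [k x y|k x y|u v].
- by rewrite !tmapP tens_assocP.
- rewrite !tmapP otimesPr tens_assocP scalerDr.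
  exact: addrACA.
rewrite [X in tens_assoc (tmap _ _ X) = _]tmapE [X in tens_assoc X = _]tmapE.
rewrite [X in _ = 1 ⊗ X + _]tmapE [X in _ + tens_assoc (tmap _ _ X)]tmapE.
rewrite [X in _ + tens_assoc X]tmapE /= Dalpha_Vlin otimesDl [LHS]tens_assocD.
by rewrite tens_assocE.
Qed.

(** Coassociativity must be proved together with the coaction law for [d]: the
    coproduct of [r \/ s] involves the coproduct of [r] but [d] of [s]. *)
Definition alpha_coassoc_at (x : H) : Prop :=
  tens_assoc (tmap (Dalpha K) idfun (Dalpha K x)) =
    tmap idfun (Dalpha K) (Dalpha K x) /\
  tens_assoc (tmap dalpha idfun (dalpha x)) =
    tmap idfun (Dalpha K) (dalpha x).

Lemma alpha_coassoc_tree t : alpha_coassoc_at << t >>.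
Proof.
move: t; apply: tree_mulV_ind => [|x y [IHx _] [_ IHy]]; split.
- by rewrite Dalpha1 -otimes11 !tmapE /= Dalpha1 -otimes11 tens_assocE.
- by rewrite dalpha1 -otimes11 !tmapE /= Dalpha1 dalpha1 -otimes11 tens_assocE.
- rewrite Dalpha_mulV (tmapM DalphaM (@idfunM K _)) tens_assocM IHx.
  rewrite (tmapM (@idfunM K _) DalphaM); congr (_ * _).
  rewrite [X in tens_assoc X]tmapD [RHS]tmapD [LHS]tens_assocD.
  rewrite [X in tens_assoc X + _]tmapE [X in _ = X + _]tmapE /= Dalpha1.
  rewrite tmap_Dalpha_Vlin -otimes11 tens_assocE IHy Dalpha_Vlin otimesDr.
  by rewrite tmap_Vlin_Dalpha addrA.
- rewrite dalpha_mulV tmap_dalpha_mulV tens_assocM tens_assoc_Vlin.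
  by rewrite [X in X * _]IHx [X in _ * tmap _ _ X]IHy tmap_Dalpha_mulV.
Qed.

Lemma alpha_coassoc x :
  tens_assoc (tmap (Dalpha K) idfun (Dalpha K x)) =
    tmap idfun (Dalpha K) (Dalpha K x).
Proof.
move: x; apply: malg_lin_eq => [k x y|k x y|t].
- by rewrite DalphaP tmapP tens_assocP.
- by rewrite DalphaP tmapP.
exact: (proj1 (alpha_coassoc_tree t)).
Qed.

Lemma epsalphaP : linear (epsalpha K).
Proof. exact: linearP. Qed.

Lemma epsalphaU t : epsalpha K << t >> = (t == Leaf)%:R.
Proof. exact: linextU. Qed.

Lemma epsalpha1 : epsalpha K 1 = 1.
Proof. exact: (epsalphaU Leaf). Qed.

Lemma epsalphaM : {morph epsalpha K : x y / x * y}.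
Proof.
move=> x y; move: x; apply: malg_lin_eq => [k x x'|k x x'|t].
- by rewrite malgPM epsalphaP.
- by rewrite epsalphaP mulrDl scalerAl.
move: y; apply: malg_lin_eq => [k y y'|k y y'|s].
- by rewrite malgMP epsalphaP.
- by rewrite epsalphaP mulrDr scalerAr.
rewrite malgU_mul !epsalphaU -natrM mulnb.
by case: s => [|r s] /=; rewrite ?andbT ?andbF.
Qed.

Lemma epsalphaV x : epsalpha K (Vlin x) = 0.
Proof.
move: x; apply: malg_lin_eq => [k x y|k x y|t].
- by rewrite VlinP epsalphaP.
- by rewrite scaler0 addr0.
by rewrite VlinU epsalphaU.
Qed.

Lemma alpha_counitl x : contractl (epsalpha K) (Dalpha K x) = x.
Proof.
have cM w w' : contractl (epsalpha K) (w * w') =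
    contractl (epsalpha K) w * contractl (epsalpha K) w'.
  move: w; apply: otimes_lin_eq => [k u v|k u v|u v].
  - by rewrite malgPM contractlP.
  - by rewrite contractlP malgPM.
  move: w'; apply: otimes_lin_eq => [k u' v'|k u' v'|u' v'].
  - by rewrite malgMP contractlP.
  - by rewrite contractlP malgMP.
  by rewrite otimesM !contractlE /= epsalphaM -scalerAl -malg_scalerAr scalerA.
have cV w : contractl (epsalpha K) (tmap (@Vlin K) idfun w) = 0.
  move: w; apply: otimes_lin_eq => [k u v|k u v|u v].
  - by rewrite tmapP contractlP.
  - by rewrite scaler0 addr0.
  by rewrite tmapE contractlE /= epsalphaV scale0r.
move: x; apply: alpha_lin_eq => [k x y|//||x y IHx _].
- by rewrite DalphaP contractlP.
- by rewrite Dalpha1 -otimes11 contractlE /= epsalpha1 scale1r.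
rewrite Dalpha_mulV cM IHx /DalphaV contractlD cV addr0.
by rewrite contractlE /= epsalpha1 scale1r.
Qed.

Lemma alpha_counitr x : contractr (epsalpha K) (Dalpha K x) = x.
Proof.
have cM w w' : contractr (epsalpha K) (w * w') =
    contractr (epsalpha K) w * contractr (epsalpha K) w'.
  move: w; apply: otimes_lin_eq => [k u v|k u v|u v].
  - by rewrite malgPM contractrP.
  - by rewrite contractrP malgPM.
  move: w'; apply: otimes_lin_eq => [k u' v'|k u' v'|u' v'].
  - by rewrite malgMP contractrP.
  - by rewrite contractrP malgMP.
  by rewrite otimesM !contractrE /= epsalphaM -scalerAl -malg_scalerAr scalerA.
have cV w : contractr (epsalpha K) (tmap (@Vlin K) idfun w) =
    Vlin (contractr (epsalpha K) w).
  move: w; apply: otimes_lin_eq => [k u v|k u v|u v].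
  - by rewrite tmapP contractrP.
  - by rewrite contractrP VlinP.
  by rewrite tmapE !contractrE linearZ.
pose P y := contractr (epsalpha K) (Dalpha K y) = y /\
  contractr (epsalpha K) (dalpha y) = y.
(* The counit of [d] is needed as well, since the coproduct of [V s] is built
   from [d s]. *)
suff: forall t, P << t >>.
  move=> ct; move: x; apply: malg_lin_eq => [k x y|k x y|t] //.
    by rewrite DalphaP contractrP.
  exact: (proj1 (ct t)).
apply: tree_mulV_ind => [|y z [IHy _] [_ IHz]]; rewrite /P.
  by rewrite Dalpha1 dalpha1 -otimes11 contractrE /= epsalpha1 scale1r.
split.
  rewrite Dalpha_mulV cM [X in X * _ = _]IHy /DalphaV contractrD cV IHz.
  by rewrite contractrE /= epsalphaV scale0r add0r.
by rewrite dalpha_mulV cM [X in X * _ = _]IHy cV IHz.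
Qed.
End TreeCoalgebra.

(** * Convolution and the antipode of a filtered connected bialgebra *)

Section Convolution.
Variables (K : comNzRingType) (M : monomType).
Notation H := {malg K[M]}.
Notation HH := {malg K[(M * M)%type]}.
Variables (Delta : {linear H -> HH}) (eps : {linear H -> K^o}).
Implicit Types (f g h : {linear H -> H}).

Definition conv f g (x : H) : H := tens_mul (tmap f g (Delta x)).

Lemma convP f g : linear (conv f g).
Proof. by move=> k x y; rewrite /conv linearP tmapP tens_mulP. Qed.
HB.instance Definition _ f g :=
  GRing.isLinear.Build K H H *:%R (conv f g) (convP f g).

Definition conv_unit (x : H) : H := (eps x : K) *: 1.

Lemma conv_unitP : linear conv_unit.
Proof. by move=> k x y; rewrite /conv_unit linearP scalerDl scalerA. Qed.
HB.instance Definition _ :=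
  GRing.isLinear.Build K H H *:%R conv_unit conv_unitP.

(** The identity is [conv_unit] minus this map, so its convolution inverse, the
    antipode, is the sum of the convolution powers of this map. *)
Definition conv_defect (x : H) : H := conv_unit x - x.

Lemma conv_defectP : linear conv_defect.
Proof.
move=> k x y; rewrite /conv_defect conv_unitP scalerBr opprD; exact: addrACA.
Qed.
HB.instance Definition _ :=
  GRing.isLinear.Build K H H *:%R conv_defect conv_defectP.

Fixpoint defect_pow (k : nat) : {linear H -> H} :=
  if k is k'.+1 then conv conv_defect (defect_pow k') else conv_unit.

Definition defect_sum (n : nat) (x : H) : H := \sum_(k < n) defect_pow k x.

Lemma defect_sumP n : linear (defect_sum n).
Proof.
move=> k x y; rewrite /defect_sum scaler_sumr -big_split.
by apply: eq_bigr => i _; rewrite linearP.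
Qed.
HB.instance Definition _ n :=
  GRing.isLinear.Build K H H *:%R (defect_sum n) (defect_sumP n).

Lemma tmap_linl f f1 f2 (g : {linear H -> H}) k (w : HH) :
  (forall x, f x = k *: f1 x + f2 x) ->
  tmap f g w = k *: tmap f1 g w + tmap f2 g w.
Proof.
move=> fE; move: w; apply: otimes_lin_eq => [c x y|c x y|u v].
- exact: tmapP.
- rewrite !tmapP !scalerDr !scalerA [k * c]mulrC; exact: addrACA.
by rewrite !tmapE fE otimesPl.
Qed.

Lemma tmap_linr f f1 f2 (g : {linear H -> H}) k (w : HH) :
  (forall x, f x = k *: f1 x + f2 x) ->
  tmap g f w = k *: tmap g f1 w + tmap g f2 w.
Proof.
move=> fE; move: w; apply: otimes_lin_eq => [c x y|c x y|u v].
- exact: tmapP.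
- rewrite !tmapP !scalerDr !scalerA [k * c]mulrC; exact: addrACA.
by rewrite !tmapE fE otimesPr.
Qed.

Lemma conv_linl f f1 f2 g k x : (forall x, f x = k *: f1 x + f2 x) ->
  conv f g x = k *: conv f1 g x + conv f2 g x.
Proof. by move=> fE; rewrite /conv (tmap_linl g _ fE) tens_mulP. Qed.

Lemma conv_linr f f1 f2 g k x : (forall x, f x = k *: f1 x + f2 x) ->
  conv g f x = k *: conv g f1 x + conv g f2 x.
Proof. by move=> fE; rewrite /conv (tmap_linr g _ fE) tens_mulP. Qed.

Lemma conv_ext f f' g g' : f =1 f' -> g =1 g' -> conv f g =1 conv f' g'.
Proof. by move=> ff gg x; rewrite /conv (tmap_ext ff gg). Qed.

Lemma tens_mul_assoc (w : {malg K[((M * M) * M)%type]}) :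
  tens_mul (tmap (@tens_mul K M) idfun w) =
    tens_mul (tmap idfun (@tens_mul K M) (tens_assoc w)).
Proof.
move: w; apply: otimes3_lin_eq => [k x y|k x y|u v t].
- by rewrite tmapP tens_mulP.
- by rewrite tens_assocP tmapP tens_mulP.
by rewrite tens_assocE !tmapE /= !tens_mulE mulrA.
Qed.

Hypothesis coassoc : forall x,
  tens_assoc (tmap Delta idfun (Delta x)) = tmap idfun Delta (Delta x).
Hypothesis counitl : forall x, contractl eps (Delta x) = x.
Hypothesis counitr : forall x, contractr eps (Delta x) = x.

Lemma conv_assoc f g h x : conv (conv f g) h x = conv f (conv g h) x.
Proof.
have El w : tmap (conv f g) h w =
    tmap (@tens_mul K M) idfun (tmap (tmap f g) h (tmap Delta idfun w)).
  by rewrite [X in _ = tmap _ _ X]tmap_comp [RHS]tmap_comp; exact: tmap_ext.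
have Er w : tmap f (conv g h) w =
    tmap idfun (@tens_mul K M) (tmap f (tmap g h) (tmap idfun Delta w)).
  by rewrite [X in _ = tmap _ _ X]tmap_comp [RHS]tmap_comp; exact: tmap_ext.
rewrite /conv [tmap (conv f g) h _]El [tmap f (conv g h) _]Er.
by rewrite tens_mul_assoc tens_assoc_tmap coassoc.
Qed.

Lemma conv_unitl f x : conv conv_unit f x = f x.
Proof.
suff E w : tens_mul (tmap conv_unit f w) = f (contractl eps w).
  by rewrite /conv E counitl.
move: w; apply: otimes_lin_eq => [k u v|k u v|u v].
- by rewrite tmapP tens_mulP.
- by rewrite contractlP linearP.
by rewrite tmapE tens_mulE contractlE linearZ /= -scalerAl mul1r.
Qed.

Lemma conv_unitr f x : conv f conv_unit x = f x.
Proof.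
suff E w : tens_mul (tmap f conv_unit w) = f (contractr eps w).
  by rewrite /conv E counitr.
move: w; apply: otimes_lin_eq => [k u v|k u v|u v].
- by rewrite tmapP tens_mulP.
- by rewrite contractrP linearP.
by rewrite tmapE tens_mulE contractrE linearZ /= -malg_scalerAr mulr1.
Qed.

(** Associativity lets the extra factor move to the right end, which makes the
    geometric series a left inverse as well as a right inverse. *)
Lemma defect_powSr k x :
  defect_pow k.+1 x = conv (defect_pow k) conv_defect x.
Proof.
elim: k x => [|k IHk] x; first by rewrite conv_unitl /= conv_unitr.
rewrite -[LHS]/(conv conv_defect (defect_pow k.+1) x).
rewrite (conv_ext (g' := conv (defect_pow k) conv_defect) (frefl _) IHk).
by rewrite -conv_assoc.
Qed.

(** These three decompositions have the shape that [conv_linl] and [conv_linr]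
    expect. *)
Lemma idfun_defect (x : H) : idfun x = -1 *: conv_defect x + conv_unit x.
Proof. by rewrite /conv_defect scaleN1r opprB subrK. Qed.

Lemma defect_sum0 (x : H) : defect_sum 0 x = -1 *: idfun x + idfun x.
Proof. by rewrite /defect_sum big_ord0 scaleN1r addNr. Qed.

Lemma defect_sumS n (x : H) :
  defect_sum n.+1 x = 1 *: defect_pow n x + defect_sum n x.
Proof. by rewrite /defect_sum big_ord_recr addrC scale1r. Qed.

Lemma defect_telescope n (x : H) :
  - defect_pow n.+1 x + defect_pow n x + (conv_unit x - defect_pow n x) =
    conv_unit x - defect_pow n.+1 x.
Proof. by rewrite addrA addrAC addrK addrC. Qed.

Lemma conv_defect_suml n x :
  conv (defect_sum n) idfun x = conv_unit x - defect_pow n x.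
Proof.
elim: n => [|n IHn].
  by rewrite (conv_linl idfun x defect_sum0) scaleN1r addNr subrr.
rewrite (conv_linl idfun x (defect_sumS n)) scale1r IHn.
rewrite (conv_linr (defect_pow n) x idfun_defect) scaleN1r -defect_powSr.
by rewrite conv_unitr defect_telescope.
Qed.

Lemma conv_defect_sumr n x :
  conv idfun (defect_sum n) x = conv_unit x - defect_pow n x.
Proof.
elim: n => [|n IHn].
  by rewrite (conv_linr idfun x defect_sum0) scaleN1r addNr subrr.
rewrite (conv_linr idfun x (defect_sumS n)) scale1r IHn.
rewrite (conv_linl (defect_pow n) x idfun_defect) scaleN1r conv_unitl.
by rewrite -[conv _ _ _]/(defect_pow n.+1 x) defect_telescope.
Qed.

Variable deg : M -> nat.
Hypothesis deg0 : forall m, deg m = 0%N -> m = mone.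
Hypothesis eps1 : eps 1 = 1.
Hypothesis deg_comul : forall m p,
  p \in msupp (Delta << m >>) -> (deg p.1 + deg p.2 <= deg m)%N.

Lemma conv_defect1 : conv_defect << mone >> = 0.
Proof. by rewrite /conv_defect /conv_unit [eps _]eps1 scale1r subrr. Qed.

(** Each factor [conv_defect] kills degree 0, hence uses up at least one unit of
    the degree that the coproduct distributes. *)
Lemma defect_pow_vanish k m : (deg m < k)%N -> defect_pow k << m >> = 0.
Proof.
elim: k m => // k IHk m; rewrite ltnS => lt_mk.
rewrite /= /conv (malg_sumU (Delta << m >>)) !linear_sum big_seq big1 // => p.
move=> /deg_comul le_p; rewrite linearZ /= [tmap _ _ _](_ : _ = 0).
  by rewrite scaler0 linear0.
case: p => p1 p2 /= in le_p *; rewrite -otimesUU tmapE /=.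
have [/deg0 -> | p1_gt0] := posnP (deg p1).
  by rewrite conv_defect1 otimes0l.
rewrite IHk ?otimes0r // (leq_trans _ lt_mk) //.
by rewrite (leq_trans _ le_p) // -{1}[deg p2]add0n ltn_add2r.
Qed.

(** The series is cut at the degree of each basis element, beyond which its
    terms vanish. *)
Definition antipode : H -> H :=
  linext (fun m => defect_sum (deg m).+1 << m >>).
HB.instance Definition _ := GRing.Linear.on antipode.

Lemma antipodeU m n : (deg m < n)%N -> antipode << m >> = defect_sum n << m >>.
Proof.
move=> lt_mn; rewrite [LHS]linextU /defect_sum.
rewrite -(subnKC lt_mn) big_split_ord /= [X in _ = _ + X]big1 ?addr0 // => i _.
by apply: (@defect_pow_vanish (deg m + i).+1); rewrite ltnS leq_addr.
Qed.

Lemma antipode_suppE (u : H) n :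
  (forall m, m \in msupp u -> (deg m < n)%N) -> antipode u = defect_sum n u.
Proof.
move=> lt_un; rewrite (malg_sumU u) !linear_sum /= !big_seq.
by apply: eq_bigr => m /lt_un lt_mn; rewrite !linearZ /= (antipodeU lt_mn).
Qed.

(** On the two legs of the coproduct of [m] the antipode agrees with the partial
    sum taken at the degree of [m], to which telescoping applies. *)
Lemma conv_antipodel x : conv antipode idfun x = conv_unit x.
Proof.
move: x; apply: malg_lin_eq => [||m]; [exact: convP|exact: conv_unitP|].
rewrite -[RHS]subr0 -(@defect_pow_vanish (deg m).+1 m) // -conv_defect_suml.
rewrite /conv (malg_sumU (Delta << m >>)) !linear_sum /= !big_seq.
apply: eq_bigr => p /deg_comul le_p; rewrite !linearZ /=; congr (_ *: tens_mul _).
case: p => p1 p2 /= in le_p *; rewrite -otimesUU !tmapE /=.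
by rewrite (@antipodeU p1 (deg m).+1) // ltnS (leq_trans _ le_p) ?leq_addr.
Qed.

Lemma conv_antipoder x : conv idfun antipode x = conv_unit x.
Proof.
move: x; apply: malg_lin_eq => [||m]; [exact: convP|exact: conv_unitP|].
rewrite -[RHS]subr0 -(@defect_pow_vanish (deg m).+1 m) // -conv_defect_sumr.
rewrite /conv (malg_sumU (Delta << m >>)) !linear_sum /= !big_seq.
apply: eq_bigr => p /deg_comul le_p; rewrite !linearZ /=; congr (_ *: tens_mul _).
case: p => p1 p2 /= in le_p *; rewrite -otimesUU !tmapE /=.
by rewrite (@antipodeU p2 (deg m).+1) // ltnS (leq_trans _ le_p) ?leq_addl.
Qed.
End Convolution.

(** * The coproduct of trees respects the number of nodes *)

Section Support.
Variable K : comNzRingType.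

Section SupportModule.
Variable M : choiceType.

Definition supp_in (P : pred M) (u : {malg K[M]}) : Prop :=
  forall m, m \in msupp u -> P m.

Lemma supp_inU (P : pred M) m : P m -> supp_in P << m >>.
Proof. by move=> Pm n /(fsubsetP msuppU_le); rewrite inE => /eqP ->. Qed.

Lemma supp_inD P u v : supp_in P u -> supp_in P v -> supp_in P (u + v).
Proof.
move=> Pu Pv m /(fsubsetP (msuppD_le u v)); rewrite in_fsetU.
by case/orP => [/Pu | /Pv].
Qed.

Lemma supp_inZ P k u : supp_in P u -> supp_in P (k *: u).
Proof. by move=> Pu m /(fsubsetP (msuppZ_le k u)) /Pu. Qed.

Lemma supp_in_sum P I (r : seq I) (Q : pred I) (F : I -> {malg K[M]}) :
  (forall i, Q i -> supp_in P (F i)) -> supp_in P (\sum_(i <- r | Q i) F i).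
Proof.
move=> PF; elim/big_rec: _ => [m|i u Qi Pu]; first by rewrite msupp0 inE.
by apply: supp_inD => //; apply: PF.
Qed.

End SupportModule.

Lemma supp_in_linext (M N : choiceType) (P : pred M) (Q : pred N)
    (h : M -> {malg K[N]}) u :
  supp_in P u -> (forall m, P m -> supp_in Q (h m)) ->
  supp_in Q (linext h u).
Proof.
move=> Pu Ph; rewrite /linext big_seq; apply: supp_in_sum => m /Pu Pm.
by apply: supp_inZ; apply: Ph.
Qed.

Lemma supp_inM (M : monomType) (P Q S : pred M) (u v : {malg K[M]}) :
  supp_in P u -> supp_in Q v ->
  (forall m n, P m -> Q n -> S (mmul m n)) -> supp_in S (u * v).
Proof.
move=> Pu Qv PQS m /msuppM_le[m1 [m2 [in1 in2 ->]]].
by apply: PQS; [apply: Pu | apply: Qv].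
Qed.

Definition bidegree_le (n : nat) (p : bintree * bintree) : bool :=
  (nodes p.1 + nodes p.2 <= n)%N.

Lemma nodes_over t s : nodes (Defs.over t s) = (nodes t + nodes s)%N.
Proof. by elim: s => [|r IHr s _] /=; rewrite ?addn0 // IHr addnS addnA. Qed.

Lemma bidegree_leM i j (w w' : {malg K[(bintree * bintree)%type]}) :
  supp_in (bidegree_le i) w -> supp_in (bidegree_le j) w' ->
  supp_in (bidegree_le (i + j)) (w * w').
Proof.
move=> wi wj; apply: supp_inM wi wj _ => -[r1 r2] [s1 s2] /=.
rewrite /bidegree_le /= !nodes_over addnACA; exact: leq_add.
Qed.

Lemma bidegree_le_VxId n (w : {malg K[(bintree * bintree)%type]}) :
  supp_in (bidegree_le n) w -> supp_in (bidegree_le n.+1) (VxId w).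
Proof.
move=> wn; apply: supp_in_linext wn _ => -[r s] /= le_rs.
by rewrite /Vlin linextU /tens !linextU; apply: supp_inU.
Qed.

Lemma bidegree_le_comul t :
  supp_in (bidegree_le (nodes t)) (Dalpha_tree K t) /\
  supp_in (bidegree_le (nodes t)) (dalpha_tree K t).
Proof.
elim: t => [|r [IHr _] s [_ IHs]] /=; first by split; apply: supp_inU.
rewrite -addnS; split; apply: bidegree_leM => //.
  apply: supp_inD; last exact: bidegree_le_VxId.
  by apply: supp_inU; rewrite /bidegree_le.
exact: bidegree_le_VxId.
Qed.

Lemma bidegree_Dalpha t p : p \in msupp (Dalpha K << t >>) ->
  (nodes p.1 + nodes p.2 <= nodes t)%N.
Proof. by rewrite /Dalpha linextU; case: (bidegree_le_comul t) => + _; apply. Qed.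
End Support.

(** * Sums over antidiagonals and coefficients of powers *)

Section SumLemmas.

Lemma antidiag_sum (V : nmodType) (N n : nat) (F : nat -> nat -> V) :
  (n < N)%N ->
  \sum_(i < n.+1) F i (n - i)%N =
    \sum_(i < N) \sum_(j < N | (i + j == n)%N) F i j.
Proof.
move=> lt_nN; rewrite (big_ord_widen N (fun i => F i (n - i)%N)) //.
rewrite big_mkcond; apply: eq_bigr => i _; rewrite ltnS.
case: leqP => [le_in | lt_ni]; last first.
  rewrite big1 // => j /eqP ij; move: lt_ni.
  by rewrite -ij ltnNge leq_addr.
have lt_N : (n - i < N)%N by rewrite (leq_ltn_trans _ lt_nN) ?leq_subr.
rewrite (big_pred1 (Ordinal lt_N)) // => j.
transitivity (j == n - i :> nat)%N; last by [].
by rewrite -[RHS](eqn_add2l i) subnKC.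
Qed.

(** Both sides are the coefficient of [X^n] in a product of three polynomials. *)
Lemma convolution_sumA (R : nzRingType) (f g h : nat -> R) n :
  \sum_(i < n.+1) (\sum_(a < i.+1) f a * g (i - a)%N) * h (n - i)%N =
  \sum_(a < n.+1) f a * (\sum_(j < (n - a).+1) g j * h (n - a - j)%N).
Proof.
pose P e := \poly_(i < n.+1) (e i : R).
have PE e i : (i <= n)%N -> (P e)`_i = e i by move=> le_in; rewrite coef_poly ltnS le_in.
have PM e e' i : (i <= n)%N ->
    (P e * P e')`_i = \sum_(a < i.+1) e a * e' (i - a)%N.
  move=> le_in; rewrite coefM; apply: eq_bigr => a _; rewrite !PE //.
    by rewrite (leq_trans (leq_subr _ _)).
  by rewrite (leq_trans _ le_in) // -ltnS.
transitivity ((P f * P g * P h)`_n).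
  rewrite coefM; apply: eq_bigr => i _; rewrite PM -1?ltnS // PE //.
  by rewrite leq_subr.
rewrite -mulrA coefM; apply: eq_bigr => i _.
by rewrite PM ?leq_subr // PE // -ltnS.
Qed.

Lemma coef_exp_lt (R : nzRingType) (p : {poly R}) k i :
  p`_0 = 0 -> (i < k)%N -> (p ^+ k)`_i = 0.
Proof.
move=> p0; elim: k i => // k IHk i lt_ik.
rewrite exprS coefM big1 // => -[[|j] /= lt_ji] _; first by rewrite p0 mul0r.
rewrite IHk ?mulr0 // ltn_subLR //; apply: leq_trans lt_ik _.
by rewrite addSn ltnS leq_addl.
Qed.
End SumLemmas.

(** * The coproduct of the sum of all trees of a given size *)

(** Locked, so that [tsum 0] and [tsum n.+1] are not compared by enumerating
    trees. *)
HB.lock Definition tsum (K : comNzRingType) (n : nat) : Halpha K :=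
  tree_sum K n.

Section TreeSums.
Variable K : comNzRingType.
Notation H := (Halpha K).
Notation T := (tsum K).

Lemma tsumE h n : (n <= h)%N ->
  T n = \sum_(t <- trees_upto h | nodes t == n) << t >>.
Proof.
move=> le_nh; rewrite tsum.unlock /tree_sum /trees -[RHS]big_filter; apply: perm_big.
apply: uniq_perm; rewrite ?filter_uniq ?trees_upto_uniq // => t.
rewrite !mem_filter; case: eqP => //= tn.
by rewrite !mem_trees_upto // tn.
Qed.

Lemma tsum0 : T 0 = 1.
Proof. by rewrite tsum.unlock /tree_sum /trees /= big_seq1. Qed.

Lemma tsumS n : T n.+1 = \sum_(i < n.+1) T i * Vlin (T (n - i)).
Proof.
rewrite (tsumE (leqnn n.+1)) /= big_cons /=.
rewrite big_mkcond big_allpairs_dep /=.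
transitivity (\sum_(r <- trees_upto n | (nodes r < n.+1)%N)
  \sum_(s <- trees_upto n | nodes s == (n - nodes r)%N) (<< Node r s >> : H)).
  rewrite [RHS]big_mkcond /=; apply: eq_bigr => r _.
  rewrite -big_mkcond /=; case: ltnP => [le_rn | lt_nr].
    by apply: eq_bigl => s; rewrite eqSS -[RHS](eqn_add2l (nodes r)) subnKC.
  rewrite big1 // => s; rewrite eqSS => /eqP rs; move: lt_nr.
  by rewrite -rs ltnNge leq_addr.
rewrite (partition_big (fun r => inord (nodes r) : 'I_n.+1) xpredT) //=.
apply: eq_bigr => i _.
have le_in : (i <= n)%N by rewrite -ltnS.
rewrite (tsumE le_in) (tsumE (leq_subr i n)) mulr_suml.
apply: eq_big => [r | r /andP[lt_rn /eqP def_i]].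
  by case: ltnP => [lt_rn | le_nr] /=;
    [rewrite -val_eqE /= inordK | rewrite gtn_eqF // (leq_trans (ltn_ord i))].
rewrite (linear_sum (@Vlin K)) mulr_sumr -def_i inordK //.
by apply: eq_bigr => s _; rewrite mul_treeV.
Qed.

(** By [DalphaV], the coproduct of [x / V y] is [d (x / V y)] plus
    [Delta x / (1 (x) V y)].  Summing over all trees and applying the induction
    hypothesis to [x] recombines the second legs, by [tsumS]. *)
Lemma Dalpha_tree_sum n :
  Dalpha K (T n) = \sum_(a < n.+1) dalpha (T a) * (1 ⊗ T (n - a)%N).
Proof.
have [m] := ubnP n; elim: m n => // m IHm [|n] lt_nm.
  by rewrite big_ord1 tsum0 Dalpha1 dalpha1 otimes11 mulr1.
have -> : \sum_(a < n.+2) dalpha (T a) * (1 ⊗ T (n.+1 - a)%N) =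
    \sum_(a < n.+1) dalpha (T a) * (1 ⊗ T (n.+1 - a)%N) + dalpha (T n.+1).
  rewrite big_ord_recr; congr (_ + _).
  by rewrite /= subnn tsum0 otimes11 mulr1.
rewrite [in dalpha (T n.+1)]tsumS [in LHS]tsumS.
rewrite [LHS](linear_sum (Dalpha K)) [X in _ = _ + X](linear_sum (@dalpha K)).
transitivity (\sum_(i < n.+1)
   ((\sum_(a < i.+1) dalpha (T a) * (1 ⊗ T (i - a)%N))
      * (1 ⊗ Vlin (T (n - i)%N)) + dalpha (T i * Vlin (T (n - i)%N)))).
  apply: eq_bigr => i _ /=; rewrite Dalpha_mulV dalpha_mulV [LHS]mulrDr IHm //.
  by rewrite (leq_trans (ltn_ord i)) // -ltnS.
rewrite [LHS]big_split; apply: (congr1 (fun z => z + _)).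
apply: (etrans (convolution_sumA (fun a => dalpha (T a)) (fun b => 1 ⊗ T b)
  (fun c => 1 ⊗ Vlin (T c)) n)).
apply: eq_bigr => a _; apply: (congr1 (fun z => _ * z)).
rewrite subSn -1?ltnS // tsumS otimes_sumr; apply: eq_bigr => j _.
by rewrite otimesM mulr1.
Qed.

Lemma tsum_antidiag N n : (n < N)%N ->
  T n.+1 = \sum_(i < N) \sum_(j < N | (i + j == n)%N) T i * Vlin (T j).
Proof.
move=> lt_nN.
by rewrite tsumS (antidiag_sum (fun i j => T i * Vlin (T j)) lt_nN).
Qed.

(** Expand [T k] by [tsumS]; on the right the pairs with [N <= i + j + 1]
    contribute nothing. *)
Lemma tsum_antidiag_otimes N (c : nat -> H) :
  c 0%N = 0 -> (forall k, (N <= k)%N -> c k = 0) ->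
  \sum_(k < N) T k ⊗ c k =
    \sum_(i < N) \sum_(j < N) (T i * Vlin (T j)) ⊗ c (i + j).+1.
Proof.
case: N => [|N] c0 cN; first by rewrite !big_ord0.
rewrite big_ord_recl c0 otimes0r add0r.
transitivity (\sum_(k < N) \sum_(i < N.+1) \sum_(j < N.+1 | (i + j == k)%N)
    (T i * Vlin (T j)) ⊗ c k.+1).
  apply: eq_bigr => k _.
  rewrite [T _](tsum_antidiag (leqW (ltn_ord k))) otimes_suml.
  by apply: eq_bigr => i _; rewrite otimes_suml.
rewrite exchange_big; apply: eq_bigr => i _.
rewrite (exchange_big_dep xpredT) //=; apply: eq_bigr => j _.
case: (ltnP (i + j) N) => [lt_ijN | le_Nij].
  by rewrite (big_pred1 (Ordinal lt_ijN)).
rewrite cN // otimes0r big1 // => k /eqP ijk.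
by move: (ltn_ord k); rewrite -ijk ltnNge le_Nij.
Qed.

(** [u] stands for [\sum_n T n x^(n+1)], known modulo [x^N]. *)
Section Residue.
Variables (N : nat) (u : {poly H}).
Hypothesis u0 : u`_0 = 0.
Hypothesis uS : forall i, (i.+1 < N)%N -> u`_i.+1 = T i.

Lemma Dalpha_residue_of m :
  (forall a, (a <= m)%N ->
     dalpha (T a) = \sum_(k < N) T k ⊗ (u ^+ k)`_a) ->
  (m.+1 < N)%N ->
  Dalpha K (T m) = \sum_(k < N) T k ⊗ (u ^+ k.+1)`_m.+1.
Proof.
move=> dT lt_mN; rewrite Dalpha_tree_sum.
transitivity (\sum_(a < m.+1) \sum_(k < N)
    T k ⊗ ((u ^+ k)`_a * T (m - a)%N)).
  apply: eq_bigr => a _; rewrite dT -1?ltnS // mulr_suml.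
  by apply: eq_bigr => k _; rewrite otimesM mulr1.
rewrite exchange_big; apply: eq_bigr => k _.
rewrite exprSr coefM [X in _ = _ ⊗ X]big_ord_recr /= subnn u0 mulr0 addr0.
rewrite otimes_sumr; apply: eq_bigr => a _.
have le_am : (a <= m)%N by rewrite -ltnS.
rewrite (subSn le_am) uS; first reflexivity.
by rewrite (leq_ltn_trans _ lt_mN) // ltnS leq_subr.
Qed.

Lemma exp_coefMS k l n :
  \sum_(i < n.+1) (u ^+ k.+1)`_i.+1 * (u ^+ l)`_(n - i) =
    (u ^+ (k + l).+1)`_n.+1.
Proof.
rewrite -addSn exprD coefM [RHS]big_ord_recl coef_exp_lt // mul0r add0r.
by apply: eq_bigr => i _; rewrite subSS.
Qed.

(** Multiplying the formulas for [Delta (T a)] and [(V (x) Id) d (T (n-a))] and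
    summing over [a] multiplies [u^(i+1)] by [u^j]. *)
Lemma dalpha_residueS n :
  (forall a, (a <= n)%N ->
     dalpha (T a) = \sum_(k < N) T k ⊗ (u ^+ k)`_a) ->
  (n.+1 < N)%N ->
  dalpha (T n.+1) = \sum_(i < N) \sum_(j < N)
    (T i * Vlin (T j)) ⊗ (u ^+ (i + j).+1)`_n.+1.
Proof.
move=> dT lt_nN; rewrite tsumS [LHS](linear_sum (@dalpha K)).
transitivity (\sum_(a < n.+1) \sum_(i < N) \sum_(j < N)
    (T i * Vlin (T j)) ⊗ ((u ^+ i.+1)`_a.+1 * (u ^+ j)`_(n - a))).
  apply: eq_bigr => a _; have le_an : (a <= n)%N by rewrite -ltnS.
  rewrite /= dalpha_mulV Dalpha_residue_of; first last.
  - by rewrite (leq_ltn_trans _ lt_nN) // ltnS.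
  - by move=> b le_ba; apply: dT; rewrite (leq_trans le_ba).
  rewrite (dT _ (leq_subr a n)) (linear_sum (tmap (@Vlin K) idfun)) /=.
  rewrite mulr_suml; apply: eq_bigr => i _; rewrite mulr_sumr.
  by apply: eq_bigr => j _; rewrite tmapE otimesM.
rewrite exchange_big; apply: eq_bigr => i _.
rewrite exchange_big; apply: eq_bigr => j _.
by rewrite -otimes_sumr exp_coefMS.
Qed.

(** Expanding [T k] on the right by [tsumS] gives the double sum of
    [dalpha_residueS], so both sides obey the same recursion in [m]. *)
Lemma dalpha_residue m : (m < N)%N ->
  dalpha (T m) = \sum_(k < N) T k ⊗ (u ^+ k)`_m.
Proof.
have [h] := ubnP m; elim: h m => // h IHh [|n] lt_mh lt_mN.
  rewrite tsum0 dalpha1 -otimes11 (bigD1 (Ordinal lt_mN)) //= big1 => [|k k0].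
    by rewrite addr0 tsum0 expr0 coef1.
  rewrite coef_exp_lt ?otimes0r // lt0n; apply: contra k0 => /eqP k0.
  by apply/eqP/val_inj.
rewrite (tsum_antidiag_otimes (c := fun k => (u ^+ k)`_n.+1)).
- apply: dalpha_residueS => // a le_an.
  by apply: IHh; [rewrite (leq_ltn_trans le_an) | rewrite (leq_ltn_trans le_an) // ltnW].
- by rewrite expr0 coef1.
- by move=> k le_Nk; rewrite coef_exp_lt // (leq_trans lt_mN).
Qed.

Lemma Dalpha_residue m : (m.+1 < N)%N ->
  Dalpha K (T m) = \sum_(k < N) T k ⊗ (u ^+ k.+1)`_m.+1.
Proof.
move=> lt_mN; apply: Dalpha_residue_of => // a le_am.
by apply: dalpha_residue; rewrite (leq_ltn_trans le_am) // ltnW.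
Qed.
End Residue.
End TreeSums.

(** * Omega is a morphism of coalgebras *)

Section CoalgebraMorphism.
Variable K : comNzRingType.
Notation H := (Halpha K).
Notation T := (tsum K).

Lemma Omega_gen i : Omega K << fmu i >> = T i.+1.
Proof. by rewrite tsum.unlock; exact: free_lift_gen. Qed.

Lemma Omega1 : Omega K 1 = 1.
Proof. exact: rmorph1. Qed.

Lemma OmegaM : {morph Omega K : x y / x * y}.
Proof. exact: rmorphM. Qed.

Lemma OmegaP : linear (Omega K).
Proof. exact: linearP. Qed.

Lemma Omega_tsum n : Omega K (a K n) = T n.
Proof. by case: n => [|n]; rewrite ?tsum0 ?Omega1 // Omega_gen. Qed.

Lemma Dalpha_Omega_coef n :
  Dalpha K (T n) = tmap (Omega K) (Omega K) (Ddif_coef K n).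
Proof.
pose u := map_poly (Omega K) (A_trunc K n.+2).
have u0 : u`_0 = 0 by rewrite coef_map coef_poly /= raddf0.
have uS i : (i.+1 < n.+2)%N -> u`_i.+1 = T i.
  by move=> lt_in; rewrite coef_map coef_poly lt_in /= Omega_tsum.
rewrite (Dalpha_residue u0 uS) // /Ddif_coef.
rewrite [RHS](linear_sum (tmap (Omega K) (Omega K))) /=.
rewrite big_ord_recr [RHS]big_ord_recl /=.
(* The term [k = n+1] on the left pairs with [u^(n+2)] and the term [k = 0] on
   the right with the constant coefficient of [A(x)]: both vanish. *)
rewrite coef_exp_lt // otimes0r addr0.
rewrite [tens 0 _]tensE otimes0l linear0 add0r; apply: eq_bigr => k _.
by rewrite tensE tmapE /= Omega_tsum -rmorphXn coef_map.
Qed.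

Lemma Hdif_lin_eq (A : lalgType K) (f g : Hdif K -> A) :
  linear f -> linear g -> f 1 = g 1 ->
  {morph f : x y / x * y} -> {morph g : x y / x * y} ->
  (forall i, f << fmu i >> = g << fmu i >>) -> forall x, f x = g x.
Proof.
move=> fL gL fg1 fM gM fgX; apply: malg_lin_eq => // -[s].
elim: s => [|i s IHs].
  rewrite (_ : FMonom [::] = mone) //.
  by apply: val_inj; rewrite /= fm1.
have -> : << FMonom (i :: s) >> = << fmu i >> * << FMonom s >> :> Hdif K.
  rewrite malgU_mul (_ : FMonom (i :: s) = mmul (fmu i) (FMonom s)) //.
  by apply: val_inj; rewrite /= fmM fmuE.
by rewrite fM gM fgX IHs.
Qed.

Lemma Omega_comul x :
  Dalpha K (Omega K x) = tmap (Omega K) (Omega K) (Ddif K x).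
Proof.
have DdifP : linear (Ddif K) by exact: linearP.
have DdifM : {morph Ddif K : x y / x * y} by exact: rmorphM.
have Ddif1 : Ddif K 1 = 1 by exact: rmorph1.
move: x; apply: Hdif_lin_eq => [k x y|k x y||x y|x y|i].
- by rewrite OmegaP DalphaP.
- by rewrite DdifP tmapP.
- by rewrite Omega1 Dalpha1 Ddif1 -[1 in RHS]otimes11 tmapE /= Omega1 otimes11.
- by rewrite OmegaM DalphaM.
- by rewrite DdifM (tmapM OmegaM OmegaM).
by rewrite Omega_gen Dalpha_Omega_coef [Ddif K _]free_lift_gen.
Qed.

Lemma Omega_counit x : epsalpha K (Omega K x) = epsdif K x.
Proof.
have epsP : linear (epsdif K) by exact: linearP.
move: x; apply: Hdif_lin_eq => [k x y|//||x y|x y|i].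
- by rewrite OmegaP epsalphaP.
- by rewrite Omega1 epsalpha1 rmorph1.
- by rewrite OmegaM epsalphaM.
- exact: rmorphM.
rewrite Omega_gen [RHS]free_lift_gen tsum.unlock.
rewrite [LHS](linear_sum (epsalpha K)) big_seq big1 // => t.
by rewrite mem_trees /= epsalphaU; case: t.
Qed.
End CoalgebraMorphism.

(** * A retraction of Omega *)

Section ConvolutionQuotient.
Variables (R : pzRingType) (s c : nat -> R).

(** The quotient of the power series [c] by [s], where [s 0 = 1].  The first
    argument is fuel: the recursive calls are at smaller [n]. *)
Fixpoint quotient_upto (h n : nat) : R :=
  if h is h'.+1 then
    c n - \sum_(i < n) s i.+1 * quotient_upto h' (n - i.+1)
  else 0.

Definition conv_quotient n := quotient_upto n.+1 n.

Lemma quotient_uptoE h n : (n < h)%N -> quotient_upto h n = conv_quotient n.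
Proof.
suff E h1 h2 : (n < h1)%N -> (n < h2)%N ->
  quotient_upto h1 n = quotient_upto h2 n by move=> lt_nh; apply: E.
elim: h1 h2 n => // h1 IH [|h2] n //; rewrite !ltnS => le1 le2 /=.
congr (_ - _); apply: eq_bigr => i _; congr (_ * _).
have lt_i : (n - i.+1 < n)%N by rewrite ltn_subrL (leq_ltn_trans (leq0n i) (ltn_ord i)).
by apply: IH; apply: leq_trans lt_i _.
Qed.

Lemma conv_quotientP : s 0%N = 1 ->
  forall n, \sum_(i < n.+1) s i * conv_quotient (n - i)%N = c n.
Proof.
move=> s0 n; rewrite big_ord_recl s0 mul1r subn0 {1}/conv_quotient /=.
rewrite -[RHS](subrK (\sum_(i < n) s i.+1 * quotient_upto n (n - i.+1))).
congr (_ + _); apply: eq_bigr => i _; rewrite quotient_uptoE //.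
by rewrite ltn_subrL (leq_ltn_trans (leq0n i) (ltn_ord i)).
Qed.
End ConvolutionQuotient.

Section Retraction.
Variable K : comNzRingType.
Notation H := (Halpha K).
Notation T := (tsum K).

Definition comb n : bintree := iter n V Leaf.

Lemma nodes_comb n : nodes (comb n) = n.
Proof. by elim: n => //= n ->. Qed.

(** [comb_coef n] is [b_(n+1)], where [b(x) = 1 - a(x)^-1] and
    [a(x) = \sum_n a_n x^n]. *)
Definition comb_coef : nat -> Hdif K :=
  conv_quotient (a K) (fun n => a K n.+1).

(** The value of the retraction at the free generator [V s].  Any choice of one
    tree for each number of nodes would do in place of [comb]. *)
Definition retractV_tree (s : bintree) : Hdif K :=
  if s == comb (nodes s) then comb_coef (nodes s) else 0.

Fixpoint retract_tree (t : bintree) : Hdif K :=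
  if t is Node r s then retract_tree r * retractV_tree s else 1.

Definition retractV : H -> Hdif K := linext retractV_tree.
Definition retract : H -> Hdif K := linext retract_tree.
HB.instance Definition _ := GRing.Linear.on retractV.
HB.instance Definition _ := GRing.Linear.on retract.

Lemma retractVP : linear retractV. Proof. exact: linearP. Qed.
Lemma retractP : linear retract. Proof. exact: linearP. Qed.

Lemma retract1 : retract 1 = 1.
Proof. exact: (linextU retract_tree Leaf). Qed.

Lemma retract_mulV x y : retract (x * Vlin y) = retract x * retractV y.
Proof.
move: x; apply: malg_lin_eq => [k x x'|k x x'|r].
- by rewrite malgPM retractP.
- by rewrite retractP malgPM.
move: y; apply: malg_lin_eq => [k y y'|k y y'|s].
- by rewrite VlinP malgMP retractP.
- by rewrite retractVP malgMP.
by rewrite mul_treeV /retract /retractV !linextU.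
Qed.

Lemma retractM : {morph retract : x y / x * y}.
Proof.
move=> x y; move: y; apply: alpha_lin_eq => [k y y'|k y y'||y z IHy _].
- by rewrite malgMP retractP.
- by rewrite retractP malgMP.
- by rewrite mulr1 retract1 mulr1.
by rewrite mulrA [LHS]retract_mulV [X in _ = _ * X](retract_mulV y) IHy mulrA.
Qed.

Lemma retractV_tsum n : retractV (T n) = comb_coef n.
Proof.
rewrite tsum.unlock [LHS](linear_sum retractV) /=.
rewrite (bigD1_seq (comb n)) ?trees_uniq ?mem_trees ?nodes_comb //=.
rewrite [X in X + _]linextU /retractV_tree nodes_comb eqxx.
rewrite big_seq_cond big1 ?addr0 // => t /andP[].
rewrite mem_trees => /eqP tn t_comb.
by rewrite [LHS]linextU /retractV_tree tn (negPf t_comb).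
Qed.

Lemma retract_tsum n : retract (T n) = a K n.
Proof.
have [m] := ubnP n; elim: m n => // m IHm [|n] lt_nm.
  by rewrite tsum0 retract1.
rewrite tsumS [LHS](linear_sum retract).
rewrite -(conv_quotientP (s := a K) (fun n => a K n.+1)) //.
apply: eq_bigr => i _ /=; rewrite retract_mulV retractV_tsum IHm //.
by rewrite (leq_trans (ltn_ord i)) // -ltnS.
Qed.

(** The relation that defines [comb_coef] is what [tsumS] becomes under the
    retraction, which therefore sends [T n] to [a_n]. *)
Lemma OmegaK : cancel (Omega K) retract.
Proof.
apply: Hdif_lin_eq => [k x y|//||x y|//|i].
- by rewrite OmegaP retractP.
- by rewrite Omega1 retract1.
- by rewrite OmegaM retractM.
by rewrite Omega_gen retract_tsum.
Qed.

Lemma Omega_inj : injective (Omega K).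
Proof. exact: can_inj OmegaK. Qed.

End Retraction.

(** * Hopf algebra structures and their transfer along Omega *)

Section HopfTransfer.
Variable K : comNzRingType.
Notation H := (Halpha K).
Notation Om := (Omega K).
Notation defect_pow_dif := (defect_pow (Ddif K) (epsdif K)).
Notation defect_pow_alpha := (defect_pow (Dalpha K) (epsalpha K)).

Lemma Omega_conv (f g : {linear Hdif K -> Hdif K}) (f' g' : {linear H -> H}) x :
  (forall y, Om (f y) = f' (Om y)) -> (forall y, Om (g y) = g' (Om y)) ->
  Om (conv (Ddif K) f g x) = conv (Dalpha K) f' g' (Om x).
Proof.
move=> ff gg; rewrite /conv -(tens_mul_tmap _ (@OmegaM K)) /= Omega_comul.
rewrite [X in tens_mul X = _]tmap_comp [X in _ = tens_mul X]tmap_comp.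
by apply: (congr1 (@tens_mul K _)); apply: tmap_ext.
Qed.

Lemma Omega_conv_unit x :
  Om (conv_unit (epsdif K) x) = conv_unit (epsalpha K) (Om x).
Proof. by rewrite /conv_unit /= Omega_counit linearZ /= Omega1. Qed.

Lemma Omega_defect x :
  Om (conv_defect (epsdif K) x) = conv_defect (epsalpha K) (Om x).
Proof. by rewrite /conv_defect linearB /= Omega_conv_unit. Qed.

Lemma Omega_defect_pow k x :
  Om (defect_pow_dif k x) = defect_pow_alpha k (Om x).
Proof.
elim: k x => [|k IHk] x; first exact: Omega_conv_unit.
by apply: Omega_conv => //; exact: Omega_defect.
Qed.

Lemma Omega_defect_sum n x :
  Om (defect_sum (Ddif K) (epsdif K) n x) =
    defect_sum (Dalpha K) (epsalpha K) n (Om x).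
Proof.
rewrite /defect_sum [LHS](linear_sum Om).
by apply: eq_bigr => k _; exact: Omega_defect_pow.
Qed.

(** The degree of a word, given that [fmu i] stands for [a_(i+1)]. *)
Definition weight (m : {fmonom nat}) : nat := \sum_(i <- (m : seq nat)) i.+1.

Lemma tsum_homogeneous n : supp_in (fun t => nodes t == n) (tsum K n).
Proof.
rewrite tsum.unlock /tree_sum big_seq; apply: supp_in_sum => t.
by rewrite mem_trees => tn; apply: supp_inU.
Qed.

Lemma Omega_homogeneous m :
  supp_in (fun t => nodes t == weight m) (Om << m >>).
Proof.
rewrite /weight [Om _]linextU /free_word.
elim: (m : seq nat) => [|i s IHs].
  by rewrite !big_nil; apply: supp_inU.
rewrite !big_cons; apply: supp_inM IHs _.
  by have := @tsum_homogeneous i.+1; rewrite tsum.unlock; apply.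
by move=> r t /eqP rn /eqP tn; rewrite [nodes _]nodes_over rn tn.
Qed.

Definition antipode_dif := antipode (Ddif K) (epsdif K) weight.
HB.instance Definition _ := GRing.Linear.on antipode_dif.
Definition antipode_alpha := antipode (Dalpha K) (epsalpha K) nodes.
HB.instance Definition _ := GRing.Linear.on antipode_alpha.

Lemma nodes_eq0 t : nodes t = 0%N -> t = mone.
Proof. by case: t. Qed.

(** Omega commutes with all partial sums of the two series, and because it is
    homogeneous both may be cut at the same place. *)
Lemma Omega_antipode x : Om (antipode_dif x) = antipode_alpha (Om x).
Proof.
move: x; apply: malg_lin_eq => [k x y|k x y|m].
- by rewrite linearP OmegaP.
- by rewrite OmegaP linearP.
rewrite [antipode_dif _]linextU Omega_defect_sum; apply: esym.
apply: (antipode_suppE nodes_eq0 (epsalpha1 K) (@bidegree_Dalpha K)).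
by move=> t /Omega_homogeneous /eqP ->.
Qed.

Lemma antipode_alphal x :
  conv (Dalpha K) antipode_alpha idfun x = conv_unit (epsalpha K) x.
Proof.
exact: (conv_antipodel (@alpha_coassoc K) (@alpha_counitl K) (@alpha_counitr K)
  nodes_eq0 (epsalpha1 K) (@bidegree_Dalpha K)).
Qed.

Lemma antipode_alphar x :
  conv (Dalpha K) idfun antipode_alpha x = conv_unit (epsalpha K) x.
Proof.
exact: (conv_antipoder (@alpha_counitl K) nodes_eq0 (epsalpha1 K)
  (@bidegree_Dalpha K)).
Qed.

(** Read off from the same identity on trees, after applying the injective map
    Omega. *)
Lemma antipode_difl x :
  conv (Ddif K) antipode_dif idfun x = conv_unit (epsdif K) x.
Proof.
apply: (@Omega_inj K); rewrite Omega_conv_unit -antipode_alphal.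
by apply: Omega_conv => // y; exact: Omega_antipode.
Qed.

Lemma antipode_difr x :
  conv (Ddif K) idfun antipode_dif x = conv_unit (epsdif K) x.
Proof.
apply: (@Omega_inj K); rewrite Omega_conv_unit -antipode_alphar.
by apply: Omega_conv => // y; exact: Omega_antipode.
Qed.

Lemma tmap_Omega3_inj :
  injective (tmap Om (tmap Om Om)).
Proof.
apply: (can_inj (g := tmap (@retract K) (tmap (@retract K) (@retract K)))) => w.
rewrite tmap_comp -[RHS]tmap_id; apply: tmap_ext => [x|y]; first exact: OmegaK.
rewrite /= tmap_comp -[RHS]tmap_id; apply: tmap_ext; exact: OmegaK.
Qed.

(** Coassociativity holds after applying the injective map Omega to all three
    factors. *)
Lemma dif_coassoc x :
  tens_assoc (tmap (Ddif K) idfun (Ddif K x)) =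
    tmap idfun (Ddif K) (Ddif K x).
Proof.
apply: tmap_Omega3_inj; rewrite -tens_assoc_tmap.
have El : tmap (tmap Om Om) Om (tmap (Ddif K) idfun (Ddif K x)) =
    tmap (Dalpha K) idfun (tmap Om Om (Ddif K x)).
  rewrite [LHS]tmap_comp [RHS]tmap_comp; apply: tmap_ext => // y.
  by rewrite /= Omega_comul.
have Er : tmap Om (tmap Om Om) (tmap idfun (Ddif K) (Ddif K x)) =
    tmap idfun (Dalpha K) (tmap Om Om (Ddif K x)).
  rewrite [LHS]tmap_comp [RHS]tmap_comp; apply: tmap_ext => // y.
  by rewrite /= Omega_comul.
rewrite [X in tens_assoc X]El [RHS]Er -Omega_comul; exact: alpha_coassoc.
Qed.

Lemma dif_counitl x : contractl (epsdif K) (Ddif K x) = x.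
Proof.
apply: (@Omega_inj K); rewrite -[RHS]alpha_counitl Omega_comul.
move: (Ddif K x); apply: otimes_lin_eq => [k u v|k u v|u v].
- by rewrite contractlP OmegaP.
- by rewrite tmapP contractlP.
by rewrite tmapE !contractlE /= Omega_counit linearZ.
Qed.

Lemma dif_counitr x : contractr (epsdif K) (Ddif K x) = x.
Proof.
apply: (@Omega_inj K); rewrite -[RHS]alpha_counitr Omega_comul.
move: (Ddif K x); apply: otimes_lin_eq => [k u v|k u v|u v].
- by rewrite contractrP OmegaP.
- by rewrite tmapP contractrP.
by rewrite tmapE !contractrE /= Omega_counit linearZ.
Qed.

Lemma dif_hopf : is_hopf_algebra (Ddif K) (epsdif K) antipode_dif.
Proof.
split.
- by split; [exact: rmorph1 | exact: rmorphM].
- by split; [exact: rmorph1 | exact: rmorphM].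
- by move=> x; have := dif_coassoc x; rewrite tmap.unlock.
- exact: dif_counitl.
- exact: dif_counitr.
- by move=> x; have := antipode_difl x; rewrite /conv tmap.unlock.
- by move=> x; have := antipode_difr x; rewrite /conv tmap.unlock.
Qed.

Lemma alpha_hopf : is_hopf_algebra (Dalpha K) (epsalpha K) antipode_alpha.
Proof.
split.
- by split; [exact: Dalpha1 | exact: DalphaM].
- by split; [exact: epsalpha1 | exact: epsalphaM].
- by move=> x; have := alpha_coassoc x; rewrite tmap.unlock.
- exact: alpha_counitl.
- exact: alpha_counitr.
- by move=> x; have := antipode_alphal x; rewrite /conv tmap.unlock.
- by move=> x; have := antipode_alphar x; rewrite /conv tmap.unlock.
Qed.

Lemma Omega_coalgebra : is_coalgebra_morphism (Ddif K) (epsdif K)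
  (Dalpha K) (epsalpha K) Om.
Proof.
split=> x; last exact: Omega_counit.
by have := Omega_comul x; rewrite tmap.unlock.
Qed.

Lemma Omega_image_hopf_sub :
  is_hopf_subalgebra (Dalpha K) antipode_alpha (fun y => exists x, y = Om x).
Proof.
split.
- by exists 1; rewrite Omega1.
- by move=> _ _ [x ->] [y ->]; exists (x * y); rewrite OmegaM.
- by move=> k _ _ [x ->] [y ->]; exists (k *: x + y); rewrite OmegaP.
- move=> _ [x ->]; pose w := Ddif K x.
  exists [seq (Om (w@_p *: << p.1 >>), Om << p.2 >>) | p <- msupp w].
    by move=> _ /mapP[p _ ->]; split; [exists (w@_p *: << p.1 >>)|exists << p.2 >>].
  rewrite big_map [LHS]Omega_comul -/w [in LHS](malg_sumU w).
  rewrite [LHS](linear_sum (tmap Om Om)).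
  apply: eq_bigr => -[m n] _ /=; rewrite tensE [LHS]linearZ /= -otimesUU tmapE.
  by rewrite linearZ otimesZl.
- by move=> _ [x ->]; exists (antipode_dif x); rewrite Omega_antipode.
Qed.
End HopfTransfer.

Theorem theorem4p1 (R : realType) :
  [/\ injective (Omega R[i]),
      is_coalgebra_morphism (Ddif R[i]) (epsdif R[i])
        (Dalpha R[i]) (epsalpha R[i]) (Omega R[i])
    & exists (Sdif : {linear Hdif R[i] -> Hdif R[i]})
             (Salpha : {linear Halpha R[i] -> Halpha R[i]}),
        [/\ is_hopf_algebra (Ddif R[i]) (epsdif R[i]) Sdif,
            is_hopf_algebra (Dalpha R[i]) (epsalpha R[i]) Salpha,
            forall x, Omega R[i] (Sdif x) = Salpha (Omega R[i] x)
          & is_hopf_subalgebra (Dalpha R[i]) Salpha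
              (fun y => exists x, y = Omega R[i] x)]].
Proof.
split; [exact: Omega_inj | exact: Omega_coalgebra |].
exists (@antipode_dif R[i]), (@antipode_alpha R[i]).
split; [exact: dif_hopf | exact: alpha_hopf | exact: Omega_antipode |].
exact: Omega_image_hopf_sub.
Qed.
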